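(* Let $(G,\rho)$ be a stationary random graph with weakly annealed polynomial growth. Then almost surely $G$ does not admit a non-constant harmonic function of sublinear growth.
   Context: A random rooted graph $(G,\rho)$ is a random variable with values in the (isomorphism classes of) rooted graphs; $G$ is assumed locally finite and almost surely connected. $V_G$ is the vertex set, $d_G$ the graph metric, and $B^G_x(r)=\{y\in V_G: d_G(x,y)\le r\}$. Conditioned on $(G,\rho)$, $\{X_n\}_{n\ge 0}$ is the simple random walk on $G$ with $X_0=\rho$. $(G,\rho)$ is stationary if $(G,X_0)$ and $(G,X_1)$ have the same law (as random rooted graphs). $(G,\rho)$ has weakly annealed polynomial growth if there are constants $c,s\ge 0$ such that for all $r\ge 1$, $\mathbb{E}[\log |B^G_\rho(r)|]\le s\log r + c$. A harmonic function on $G$ is a map $h:V_G\to\mathbb{R}$ with $\mathbb{E}[h(X_1)\mid X_0=x]=h(x)$ for all $x\in V_G$ (i.e., $h(x)$ is the average of $h$ over the neighbors of $x$). Such $h$ has sublinear growth if for every infinite sequence $\{x_n\}\subseteq V_G$ with $d_G(\rho,x_n)\to\infty$ one has $\lim_{n\to\infty}|h(x_n)|/d_G(\rho,x_n)=0$. *)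

(* Defs.v *)
From HB Require Import structures.
From mathcomp Require Import all_boot all_order all_algebra finmap.
From mathcomp Require Import all_classical all_reals all_analysis.
Import Order.TTheory GRing.Theory Num.Theory numFieldNormedType.Exports.

Set Implicit Arguments.
Unset Strict Implicit.
Unset Printing Implicit Defensive.

Local Open Scope classical_set_scope.
Local Open Scope ring_scope.

(* Simple locally finite graphs.  A connected locally finite graph is
   countable, so up to isomorphism its vertices can be taken in nat. *)
Record graph := Graph {
  vertex : set nat ;
  adj : rel nat ;
  adj_vertex : forall x y, adj x y -> vertex x ;
  adj_sym : symmetric adj ;
  adj_irr : irreflexive adj ;
  adj_locfin : forall x, finite_set [set y | adj x y] }.

Record rooted_graph := RGraph {
  rg_graph :> graph ;
  rg_root : nat ;
  rg_root_vertex : vertex rg_graph rg_root }.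

Definition walk (g : graph) (n : nat) (x y : nat) : Prop :=
  exists p : seq nat, [/\ path (adj g) x p, last x p = y & size p = n].

Definition reachable (g : graph) (x y : nat) : Prop := exists n, walk g n x y.

Definition connected_graph (g : graph) : Prop :=
  forall x y, vertex g x -> vertex g y -> reachable g x y.

Lemma reachable_walk (g : graph) (x y : nat) :
  reachable g x y -> exists n, `[< walk g n x y >].
Proof. by case=> n xy; exists n; apply/asboolP. Qed.

(* Only meaningful when y is reachable from x: the value 0 returned otherwise
   stands for an infinite distance. *)
Definition gdist (g : graph) (x y : nat) : nat :=
  if pselect (reachable g x y) is left xy then ex_minn (reachable_walk xy)
  else 0%N.

Definition gball (g : graph) (x r : nat) : set nat :=
  [set y | reachable g x y /\ (gdist g x y <= r)%N].

(* fset_set is the finite set of the elements of its argument, the latter being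
   finite here (and in deg) by local finiteness. *)
Definition card_gball (g : graph) (x r : nat) : nat :=
  #|` fset_set (gball g x r)|%fset.

Definition nbrs (g : graph) (x : nat) : {fset nat} :=
  fset_set [set y | adj g x y].

Definition deg (g : graph) (x : nat) : nat := #|` nbrs g x|%fset.

(* E[f(X_1) | X_0 = x] for the simple random walk; on the graph with a single
   vertex the walk does not move. *)
Definition srw_step (R : realType) (g : graph) (f : nat -> R) (x : nat) : R :=
  if deg g x == 0%N then f x else (\sum_(y <- nbrs g x) f y) / (deg g x)%:R.

(* E[f(X_n) | X_0 = x], by the Markov property. *)
Definition srw_mean (R : realType) (g : graph) (n : nat) (f : nat -> R) :
  nat -> R := iter n (srw_step g) f.

Definition harmonic_on (R : realType) (g : graph) (h : nat -> R) : Prop :=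
  forall x, vertex g x -> srw_mean g 1 h x = h x.

Definition nonconstant (R : realType) (g : graph) (h : nat -> R) : Prop :=
  exists x y, [/\ vertex g x, vertex g y & h x <> h y].

Definition sublinear (R : realType) (g : rooted_graph) (h : nat -> R) : Prop :=
  forall x : nat -> nat, (forall n, vertex g (x n)) ->
    gdist g (rg_root g) (x n) @[n --> \oo] --> \oo ->
    `|h (x n)| / (gdist g (rg_root g) (x n))%:R @[n --> \oo] --> 0.

Definition ball_iso (r : nat) (g g' : rooted_graph) : Prop :=
  exists phi : nat -> nat,
    [/\ set_bij (gball g (rg_root g) r) (gball g' (rg_root g') r) phi,
        phi (rg_root g) = rg_root g' &
        forall x y, gball g (rg_root g) r x -> gball g (rg_root g) r y ->
          adj g x y = adj g' (phi x) (phi y)].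

(* Balls of the local (Benjamini-Schramm) topology.  They, hence the events
   they generate, do not distinguish isomorphic connected rooted graphs: the
   sigma-algebra below is the pull-back of the Borel sigma-algebra of the space
   of isomorphism classes, and a measurable map into it is a random rooted
   graph up to isomorphism. *)
Definition local_balls : set (set rooted_graph) :=
  [set A | exists r g, A = [set g' | ball_iso r g g']].

Definition singleton_graph : graph.
Proof.
apply: (@Graph [set 0%N] (fun _ _ => false)) => // x.
by apply: (@sub_finite_set _ _ set0).
Defined.

HB.instance Definition _ := gen_eqMixin rooted_graph.
HB.instance Definition _ := gen_choiceMixin rooted_graph.
HB.instance Definition _ :=
  isPointed.Build rooted_graph (@RGraph singleton_graph 0%N erefl).

Definition rooted_graph_space := g_sigma_algebraType local_balls.

Definition reroot (g : rooted_graph) (x : nat) : rooted_graph :=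
  if pselect (vertex g x) is left gx then RGraph gx else g.

Section random_rooted_graph.
Context d (T : measurableType d) (R : realType) (P : probability T R).
Implicit Type G : {RV P >-> rooted_graph_space}.

(* The law of (G, X_n), where X is the simple random walk on G with X_0 the
   root: the probability of A is E[P((G, X_n) \in A | (G, root))]. *)
Definition law_at G (n : nat) (A : set rooted_graph_space) : \bar R :=
  'E_P[fun w => let g : rooted_graph := G w in
    srw_mean g n (fun x => \1_A (reroot g x)) (rg_root g)]%E.

Definition stationary G : Prop :=
  forall A, measurable A -> law_at G 0 A = law_at G 1 A.

Definition weakly_annealed_polynomial_growth G : Prop :=
  exists c s : R, [/\ 0 <= c, 0 <= s & forall r : nat, (1 <= r)%N ->
    ('E_P[fun w => let g : rooted_graph := G w in
       ln (card_gball g (rg_root g) r)%:R] <= (s * ln r%:R + c)%:E)%E].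

End random_rooted_graph.

(* Main.v *)
Require Import Defs.
From mathcomp Require Import all_boot all_order all_algebra finmap.
From mathcomp Require Import all_classical all_reals all_analysis.
From mathcomp Require Import measurable_realfun lra.
Import Order.TTheory GRing.Theory Num.Theory numFieldNormedType.Exports.

(** The proof is an entropy argument.  Let [H_n(x)] be the entropy of the position
    at time [n] of the walk started at [x], on a fixed graph.

    A harmonic function is controlled by the mutual information of [X_1] and
    [X_n.+1], [minfo n x = H_n.+1(x) - E_x H_n(X_1)]: when this is small, the laws of
    the walk from neighbouring starting points are close, and testing them against
    [h] shows that the gradient of [h] at [x] vanishes if
    [minfo n x * E_x |h(X_n.+1) - h(x)|^2] comes arbitrarily close to [0]
    ([gradient_le_minfo]).  This holds if, along some sequence of times, [minfo n] is
    [O(1 / n)] and the walk is diffusive, since a sublinear [h] then has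
    [E_x |h(X_n) - h(x)|^2 = o(n)].

    Diffusivity also follows from an entropy bound.  On a fixed graph, the relative
    entropy of the law of [(X_n, X_n.+1)] with respect to that of
    [(X_n.+2, X_n.+1)] is, by reversibility of the walk, an increment [revinfo n x]
    of [H_n(x) + E_x ln deg(X_n)] ([kldiv_revinfo]).  When it is small, the last step
    seen backward in time looks like one more step forward, and
    [D_n = E_x (d(x, X_n) + 1)^2] satisfies
    [(D_n.+2 - D_n)^2 <= 36 * revinfo n x * D_n.+1] ([second_moment_step]).  Hence
    [sqrt D_n] is at most of order [1 + \sum_(k < n) sqrt (revinfo k x)]
    ([second_moment_le]).

    Both kinds of information have sums over [n < N] of order [ln N], for infinitely
    many [N].  The sum of [revinfo] telescopes and is at most twice the logarithm of
    the size of a ball ([sum_revinfo_le]).  The sum of [minfo] telescopes in mean, by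
    stationarity, to the mean entropy ([integral_sum_minfo]), which is again at most
    the mean logarithm of the size of a ball.  Fatou's lemma gives infinitely many
    good [N] for almost every graph ([ae_info_growth]), and a Hardy inequality turns
    the bounds on the sums into infinitely many times [n] at which [minfo n] is
    [O(1 / n)] and [\sum_(k < n) sqrt (revinfo k x)] is [O(sqrt n)] ([good_scale]).

    Stationarity moreover gives the same bounds for the means over [k] steps of the
    walk, thus at all vertices of the graph, and [h] is constant along every edge.
    The quantities involved depend on finite balls around the root, of which there
    are countably many up to isomorphism: this makes them measurable, and lets
    stationarity pass from events to functions ([integral_srw_mean]). *)

Set Implicit Arguments.
Unset Strict Implicit.
Unset Printing Implicit Defensive.

Local Open Scope classical_set_scope.
Local Open Scope ring_scope.

(** * Relative entropy of finitely supported weights *)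

Section entropy_inequalities.
Context {R : realType}.

Lemma ln_le_subr1 (x : R) : 0 < x -> ln x <= x - 1.
Proof.
move=> x0; have := @le_ln1Dx R (x - 1).
by rewrite addrCA subrr addr0; apply; lra.
Qed.

Lemma CauchySchwarz_seq (I : Type) (s : seq I) (x y : I -> R) :
  (\sum_(i <- s) x i * y i) ^+ 2 <=
  (\sum_(i <- s) x i ^+ 2) * (\sum_(i <- s) y i ^+ 2).
Proof.
elim: s => [|i s]; first by rewrite !big_nil; lra.
rewrite !big_cons.
have : 0 <= \sum_(j <- s) x j ^+ 2 by apply: sumr_ge0 => j _; exact: sqr_ge0.
have : 0 <= \sum_(j <- s) y j ^+ 2 by apply: sumr_ge0 => j _; exact: sqr_ge0.
move: (\sum_(j <- s) x j * y j) (\sum_(j <- s) x j ^+ 2)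
  (\sum_(j <- s) y j ^+ 2) => S A B B0 A0 SAB.
move: (x i) (y i) => u v.
suff : 2 * S * (u * v) <= A * v ^+ 2 + B * u ^+ 2 by nra.
have [|] := lerP (2 * S * (u * v)) 0.
  move/le_trans; apply; apply: addr_ge0; exact: mulr_ge0 (sqr_ge0 _).
move=> pos; rewrite -ler_sqr ?nnegrE; last 2 first.
- exact: ltW.
- apply: addr_ge0; exact: mulr_ge0 (sqr_ge0 _).
apply: (@le_trans _ _ (4 * (A * B) * (u * v) ^+ 2)).
  have := ler_wpM2r (sqr_ge0 (u * v)) SAB; nra.
have := sqr_ge0 (A * v ^+ 2 - B * u ^+ 2); nra.
Qed.

(** Writing [t = sqrt b / sqrt a], this is [ln t <= t - 1] multiplied by
    [2 a]: the Hellinger distance is dominated by the relative entropy. *)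
Lemma hellinger_term_le (a b : R) : 0 <= a -> 0 <= b -> (b = 0 -> a = 0) ->
  (Num.sqrt a - Num.sqrt b) ^+ 2 <= a * (ln a - ln b) - a + b.
Proof.
move=> a0 b0 ab; have [->|an0] := eqVneq a 0.
  by rewrite sqrtr0 sub0r sqrrN sqr_sqrtr// mul0r subr0 add0r.
have agt0 : 0 < a by rewrite lt_def an0.
have bgt0 : 0 < b.
  by rewrite lt_def b0 andbT; apply/eqP => /ab /eqP; rewrite (negPf an0).
rewrite -{2 3 4}(sqr_sqrtr a0) -{2 3}(sqr_sqrtr b0).
have : 0 < Num.sqrt a by rewrite sqrtr_gt0.
have : 0 < Num.sqrt b by rewrite sqrtr_gt0.
move: (Num.sqrt a) (Num.sqrt b) => u v v0 u0.
rewrite !lnXn// !mulr2n.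
have := ln_le_subr1 (divr_gt0 v0 u0); rewrite ln_div ?posrE// => vu.
have : u ^+ 2 * (ln v - ln u) <= u * v - u ^+ 2.
  apply: le_trans (ler_wpM2l (sqr_ge0 u) vu) _.
  by rewrite mulrBr mulr1 expr2 -mulrA (mulrCA u v) divff ?gt_eqF// mulr1.
nra.
Qed.

(** Relative entropy.  As [ln 0 = 0], the differences of logarithms make it
    meaningful as soon as [a] vanishes where [b] does. *)
Definition kldiv (I : Type) (s : seq I) (a b : I -> R) :=
  \sum_(i <- s) a i * (ln (a i) - ln (b i)).

Section kldiv.
Context (I : eqType) (s : seq I) (a b : I -> R).
Hypotheses (a0 : forall i, 0 <= a i) (b0 : forall i, 0 <= b i).
Hypothesis ab0 : forall i, b i = 0 -> a i = 0.
Hypothesis ab1 : \sum_(i <- s) a i = \sum_(i <- s) b i.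

Lemma hellinger_le_kldiv :
  \sum_(i <- s) (Num.sqrt (a i) - Num.sqrt (b i)) ^+ 2 <= kldiv s a b.
Proof.
apply: (@le_trans _ _ (\sum_(i <- s) (a i * (ln (a i) - ln (b i)) - a i + b i))).
  by apply: ler_sum => i _; apply: hellinger_term_le => //; exact: ab0.
by rewrite big_split /= sumrB ab1 subrK.
Qed.

Lemma kldiv_ge0 : 0 <= kldiv s a b.
Proof.
by apply: le_trans hellinger_le_kldiv; apply: sumr_ge0 => i _; exact: sqr_ge0.
Qed.

(** A Pinsker inequality that tests the two weights against an unbounded [f]:
    factor [a - b] as a difference times a sum of square roots and apply
    Cauchy-Schwarz, the first factor being the Hellinger distance. *)
Lemma pinsker (f : I -> R) :
  (\sum_(i <- s) (a i - b i) * f i) ^+ 2 <=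
  2 * kldiv s a b * \sum_(i <- s) (a i + b i) * f i ^+ 2.
Proof.
have sq i : (a i - b i) * f i = (Num.sqrt (a i) - Num.sqrt (b i)) *
    ((Num.sqrt (a i) + Num.sqrt (b i)) * f i).
  by rewrite mulrA -subr_sqr !sqr_sqrtr.
under eq_bigr do rewrite sq.
apply: le_trans (CauchySchwarz_seq _ _ _) _.
rewrite (mulrC 2) -mulrA; apply: ler_pM.
- by apply: sumr_ge0 => i _; exact: sqr_ge0.
- by apply: sumr_ge0 => i _; exact: sqr_ge0.
- exact: hellinger_le_kldiv.
rewrite mulr_sumr; apply: ler_sum => i _.
rewrite exprMn mulrA; apply: ler_wpM2r; first exact: sqr_ge0.
rewrite -{2}(sqr_sqrtr (a0 i)) -{2}(sqr_sqrtr (b0 i)).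
have := sqr_ge0 (Num.sqrt (a i) - Num.sqrt (b i)); nra.
Qed.

End kldiv.
End entropy_inequalities.

(** * Walks, balls and distances in a graph *)

Section walks.
Variable g : graph.
Implicit Types (x y z : nat) (m n r : nat).

Lemma walk0 x y : walk g 0 x y <-> x = y.
Proof.
split=> [[p [_ <- /size0nil ->]]//|<-].
by exists [::].
Qed.

Lemma walkS n x y : walk g n.+1 x y <-> exists2 z, adj g x z & walk g n z y.
Proof.
split=> [[[|z p] /= []// /andP[xz zp] zy [pn]]|[z xz [p [zp py pn]]]].
  by exists z => //; exists p.
by exists (z :: p); rewrite /= xz zp pn.
Qed.

Lemma walkSr n x y : walk g n.+1 x y <-> exists2 z, walk g n x z & adj g z y.
Proof.
split=> [[p]|[z [p [xp pz pn]] zy]].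
  case/lastP: p => [[]//|p z []].
  rewrite rcons_path last_rcons size_rcons => /andP[xp pz] <- [pn].
  by exists (last x p) => //; exists p.
by exists (rcons p y); rewrite rcons_path xp pz zy last_rcons size_rcons pn.
Qed.

Lemma walk_cat m n x y z : walk g m x y -> walk g n y z -> walk g (m + n) x z.
Proof.
move=> [p [xp py pm]] [q [yq qz qn]]; exists (p ++ q).
by rewrite cat_path xp py yq last_cat py qz size_cat pm qn.
Qed.

Lemma gdist_walk x y : reachable g x y -> walk g (gdist g x y) x y.
Proof.
rewrite /gdist => xy; case: pselect => // xy'.
by case: ex_minnP => n /asboolP.
Qed.

Lemma gdist_le n x y : walk g n x y -> (gdist g x y <= n)%N.
Proof.
move=> xy; rewrite /gdist; case: pselect => // xy'.
by case: ex_minnP => m _; apply; exact/asboolP.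
Qed.

Lemma gballP x r y : gball g x r y <-> exists2 n, (n <= r)%N & walk g n x y.
Proof.
split=> [[xy yr]|[n nr xy]]; first by exists (gdist g x y) => //; exact: gdist_walk.
by split; [exists n | apply: leq_trans nr; exact: gdist_le].
Qed.

Lemma gball_refl x r : gball g x r x.
Proof. by apply/gballP; exists 0%N => //; exact/walk0. Qed.

Lemma gball_trans m n x y z :
  gball g x m y -> gball g y n z -> gball g x (m + n) z.
Proof.
move=> /gballP[i im xy] /gballP[j jn yz]; apply/gballP; exists (i + j)%N.
  exact: leq_add.
exact: walk_cat yz.
Qed.

Lemma gball_le m n x : (m <= n)%N -> gball g x m `<=` gball g x n.
Proof. by move=> mn y [xy ym]; split=> //; exact: leq_trans mn. Qed.

Lemma gball_adj x y : adj g x y -> gball g x 1 y.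
Proof.
by move=> xy; apply/gballP; exists 1%N => //; apply/walkS; exists y => //; exact/walk0.
Qed.

Lemma finite_gball x r : finite_set (gball g x r).
Proof.
have -> : gball g x r = \bigcup_(n in `I_r.+1) [set y | walk g n x y].
  by apply/seteqP; split=> y; [move=> /gballP[n nr xy]; exists n
                              |move=> [n nr xy]; apply/gballP; exists n].
apply: bigcup_finite; first exact: finite_II.
move=> n _; elim: n => [|n IH].
  apply: (@sub_finite_set _ _ [set x]); last exact: finite_set1.
  by move=> y /walk0 ->.
apply: (@sub_finite_set _ _ (\bigcup_(z in [set z | walk g n x z]) [set y | adj g z y])).
  by move=> y /walkSr[z xz zy]; exists z.
by apply: bigcup_finite => // z _; exact: adj_locfin.
Qed.

Definition fball x r : {fset nat} := fset_set (gball g x r).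

Lemma in_fball x r y : (y \in fball x r) <-> gball g x r y.
Proof.
by rewrite in_fset_set; [split; rewrite inE | exact: finite_gball].
Qed.

Lemma card_gball_gt0 x r : (0 < card_gball g x r)%N.
Proof.
by rewrite cardfs_gt0; apply/fset0Pn; exists x; apply/in_fball; exact: gball_refl.
Qed.

Lemma card_gball_le x m n : (m <= n)%N -> (card_gball g x m <= card_gball g x n)%N.
Proof.
move=> mn; apply: fsubset_leq_card; apply/fsubsetP => y /in_fball xy.
by apply/in_fball; exact: gball_le xy.
Qed.

Lemma gdist_step x y z : reachable g x y -> gball g y 1 z ->
  (gdist g x z <= (gdist g x y).+1)%N.
Proof.
move=> xy yz; rewrite -addn1.
have /gballP : gball g x (gdist g x y + 1) z.
  by apply: gball_trans yz; apply/gballP; exists (gdist g x y) => //; exact: gdist_walk.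
by case=> n nle xz; apply: leq_trans nle; exact: gdist_le.
Qed.

Lemma in_nbrs x y : (y \in nbrs g x) = adj g x y.
Proof.
rewrite in_fset_set; last exact: adj_locfin.
by apply/idP/idP; rewrite inE.
Qed.

(** An isolated vertex is its own successor: the step of the walk is then the
    move to a uniform successor everywhere, and it is reversible with respect
    to the number of successors. *)
Definition succs x : seq nat :=
  if deg g x == 0%N then [:: x] else nbrs g x.

Lemma succs_uniq x : uniq (succs x).
Proof. by rewrite /succs; case: ifP => // _; exact: fset_uniq. Qed.

Lemma succs_sym x y : (y \in succs x) = (x \in succs y).
Proof.
suff H u v : u \in succs v -> v \in succs u by apply/idP/idP; exact: H.
rewrite {1}/succs; case: eqVneq => [dv|dv].
  by rewrite inE => /eqP ->; rewrite /succs dv inE.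
rewrite in_nbrs => vu; rewrite /succs.
have : v \in nbrs g u by rewrite in_nbrs adj_sym.
by case: eqVneq => // /eqP; rewrite /deg cardfs_eq0 => /eqP ->; rewrite in_fset0.
Qed.

Lemma succs_gball x y : y \in succs x -> gball g x 1 y.
Proof.
rewrite /succs; case: eqVneq => [_|_]; first by rewrite inE => /eqP ->; exact: gball_refl.
by rewrite in_nbrs; exact: gball_adj.
Qed.

Lemma adj_succs x y : adj g x y -> y \in succs x.
Proof.
rewrite -in_nbrs /succs => xy; case: eqVneq => // /eqP.
by rewrite /deg cardfs_eq0 => /eqP x0; rewrite x0 in_fset0 in xy.
Qed.

Lemma size_succs_gt0 x : (0 < size (succs x))%N.
Proof. by rewrite /succs; case: eqVneq => //; rewrite -lt0n. Qed.

End walks.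

(** * The simple random walk *)

Section random_walk.
Context {R : realType} (g : graph).
Implicit Types (x y z : nat) (m n r : nat) (c : R) (f : nat -> R).

Local Notation E n f x := (srw_mean g n f x).

Lemma srw_stepE f x :
  srw_step g f x = (\sum_(y <- succs g x) f y) / (size (succs g x))%:R.
Proof.
rewrite /srw_step /succs; case: eqVneq => // _.
by rewrite big_seq1 divr1.
Qed.

Lemma srw_meanS n f x : E n.+1 f x = srw_step g (srw_mean g n f) x.
Proof. by []. Qed.

Lemma srw_meanD m n f x : E (m + n) f x = E m (srw_mean g n f) x.
Proof. by rewrite /srw_mean iterD. Qed.

Lemma srw_mean_le n f f' x :
  (forall y, gball g x n y -> f y <= f' y) -> E n f x <= E n f' x.
Proof.
elim: n x => [x|n IH x] ff'; first exact/ff'/gball_refl.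
rewrite !srw_meanS !srw_stepE ler_pM2r ?invr_gt0 ?ltr0n ?size_succs_gt0//.
rewrite big_seq [leRHS]big_seq; apply: ler_sum => y xy; apply: IH => z yz.
by apply: ff'; rewrite -add1n; apply: gball_trans yz; exact: succs_gball.
Qed.

Lemma eq_srw_mean n f f' x :
  (forall y, gball g x n y -> f y = f' y) -> E n f x = E n f' x.
Proof. by move=> ff'; apply/le_anti/andP; split; apply: srw_mean_le => y /ff'->. Qed.

Lemma srw_mean_sum (I : Type) (s : seq I) (F : I -> nat -> R) n x :
  E n (fun y => \sum_(i <- s) F i y) x = \sum_(i <- s) E n (F i) x.
Proof.
elim: n x => [//|n IH] x; rewrite srw_meanS srw_stepE.
under eq_bigr do rewrite IH.
by rewrite exchange_big mulr_suml; apply: eq_bigr => i _; rewrite srw_meanS srw_stepE.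
Qed.

Lemma srw_mean_scale c f n x : E n (fun y => c * f y) x = c * E n f x.
Proof.
elim: n x => [//|n IH] x; rewrite !srw_meanS !srw_stepE.
under eq_bigr do rewrite IH.
by rewrite -mulr_sumr mulrA.
Qed.

Lemma srw_mean_add f f' n x : E n (fun y => f y + f' y) x = E n f x + E n f' x.
Proof.
elim: n x => [//|n IH] x; rewrite !srw_meanS !srw_stepE.
under eq_bigr do rewrite IH.
by rewrite big_split mulrDl.
Qed.

Lemma srw_mean_sub f f' n x : E n (fun y => f y - f' y) x = E n f x - E n f' x.
Proof.
rewrite -[in RHS](mulN1r (E n f' x)) -srw_mean_scale -srw_mean_add.
by apply: eq_srw_mean => y _; rewrite mulN1r.
Qed.

Lemma srw_mean_cst c n x : E n (fun=> c) x = c.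
Proof.
elim: n x => [//|n IH] x; rewrite !srw_meanS !srw_stepE.
under eq_bigr do rewrite IH.
rewrite big_const_seq count_predT iter_addr addr0 -[_ *+ _]mulr_natr mulfK//.
by rewrite pnatr_eq0 -lt0n size_succs_gt0.
Qed.

Lemma srw_mean_ge0 f n x : (forall y, gball g x n y -> 0 <= f y) -> 0 <= E n f x.
Proof. by move=> f0; rewrite -(srw_mean_cst 0 n x); exact: srw_mean_le. Qed.

Definition heat_kernel n x z : R := E n (fun y => (y == z)%:R) x.

Local Notation hk := heat_kernel.

Lemma hk0E x z : hk 0 x z = (x == z)%:R.
Proof. by []. Qed.

Lemma hk_ge0 n x z : 0 <= hk n x z.
Proof. by apply: srw_mean_ge0. Qed.

Lemma hk_le1 n x z : hk n x z <= 1.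
Proof.
by rewrite -(srw_mean_cst 1 n x); apply: srw_mean_le => y _; rewrite lern1 leq_b1.
Qed.

Lemma hk_eq0 n x z : ~ gball g x n z -> hk n x z = 0.
Proof.
move=> xz; rewrite -(srw_mean_cst 0 n x); apply: eq_srw_mean => y xy.
by case: eqP => // yz; rewrite yz in xy.
Qed.

Lemma srw_mean_hk (S : {fset nat}) n f x :
  (forall z, gball g x n z -> z \in S) ->
  E n f x = \sum_(z <- S) hk n x z * f z.
Proof.
move=> xS; under eq_bigr do rewrite mulrC -srw_mean_scale.
rewrite -srw_mean_sum; apply: eq_srw_mean => y /xS yS.
rewrite (bigD1_seq y) ?fset_uniq//= eqxx mulr1 big1 ?addr0// => z zy.
by rewrite eq_sym (negPf zy) mulr0.
Qed.

Lemma sum_hk (S : {fset nat}) n x :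
  (forall z, gball g x n z -> z \in S) -> \sum_(z <- S) hk n x z = 1.
Proof.
move=> xS; rewrite -(srw_mean_cst 1 n x) (srw_mean_hk _ xS).
by apply: eq_bigr => z _; rewrite mulr1.
Qed.

(** The two-step Markov property in coordinates.  [S] only has to contain all
    positions within reach, so that one set serves several laws at once. *)
Lemma srw_mean2_hk (S : {fset nat}) m n (F : nat -> nat -> R) x :
  (forall z, gball g x (m + n) z -> z \in S) ->
  E m (fun y => E n (F y) y) x =
  \sum_(y <- S) \sum_(z <- S) hk m x y * hk n y z * F y z.
Proof.
move=> xS; rewrite (@srw_mean_hk S); last first.
  by move=> z xz; apply: xS; apply: gball_le xz; exact: leq_addr.
apply: eq_bigr => y _.
have [xy|xy] := pselect (gball g x m y); last first.
  by rewrite hk_eq0// mul0r big1// => z _; rewrite !mul0r.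
rewrite (@srw_mean_hk S); last by move=> z yz; apply: xS; exact: gball_trans yz.
by rewrite mulr_sumr; apply: eq_bigr => z _; rewrite mulrA.
Qed.

Lemma hkD m n x y z : hk m x y * hk n y z <= hk (m + n) x z.
Proof.
rewrite /heat_kernel srw_meanD -/(hk m x y) mulrC -srw_mean_scale.
apply: srw_mean_le => w _; case: eqVneq => [->|_]; first by rewrite mulr1.
by rewrite mulr0 hk_ge0.
Qed.

Lemma hk1E y z : hk 1 y z = (z \in succs g y)%:R / (size (succs g y))%:R.
Proof.
rewrite /heat_kernel srw_meanS srw_stepE; congr (_ / _).
have [zy|zy] := boolP (z \in succs g y).
  rewrite (bigD1_seq z) ?succs_uniq//= eqxx big1 ?addr0// => w wz.
  by rewrite (negPf wz).
rewrite big_seq big1// => w wy; rewrite /srw_mean /=.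
by case: (eqVneq w z) wy zy => [-> ->|].
Qed.

Lemma hk1_reversible y z :
  (size (succs g y))%:R * hk 1 y z = (size (succs g z))%:R * hk 1 z y.
Proof.
rewrite !hk1E succs_sym mulrCA mulfV ?mulr1 1?mulrCA ?mulfV ?mulr1//;
by rewrite pnatr_eq0 -lt0n size_succs_gt0.
Qed.

Lemma hk1_gt0 y z : (0 < hk 1 y z) = (z \in succs g y).
Proof.
rewrite hk1E; case: (z \in succs g y); last by rewrite mul0r ltxx.
by rewrite mul1r invr_gt0 ltr0n size_succs_gt0.
Qed.

Lemma hk_gt0 n x y : walk g n x y -> 0 < hk n x y.
Proof.
elim: n y => [y /walk0->|n IH y /walkSr[z xz zy]].
  by rewrite hk0E eqxx.
apply: (@lt_le_trans _ _ (hk n x z * hk 1 z y)).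
  by rewrite mulr_gt0 ?IH// hk1_gt0 adj_succs.
by rewrite -(addn1 n); exact: hkD.
Qed.

End random_walk.

(** * Entropy of the simple random walk *)

Section walk_entropy.
Context {R : realType} (g : graph).
Implicit Types (x y z : nat) (m n r : nat) (c : R) (f : nat -> R).

Local Notation E n f x := (srw_mean g n f x).
Local Notation hk := (@heat_kernel R g).

Definition entropy n x : R := E n (fun z => - ln (hk n x z)) x.

Lemma entropy_ge0 n x : 0 <= entropy n x.
Proof. by apply: srw_mean_ge0 => y _; rewrite oppr_ge0 ln_le0// hk_le1. Qed.

Lemma entropy0 x : entropy 0 x = 0.
Proof. by rewrite -[LHS]/(- ln (hk 0 x x)) hk0E eqxx ln1 oppr0. Qed.

(** The entropy is at most that of the uniform law on the ball; term by term
    this is [ln t <= t - 1] at [t = 1 / (p * N)]. *)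
Lemma entropy_le n x : entropy n x <= ln (card_gball g x n)%:R.
Proof.
pose S := fball g x n; pose N : R := (card_gball g x n)%:R.
have N0 : 0 < N by rewrite ltr0n card_gball_gt0.
have xS z : gball g x n z -> z \in S by move/in_fball.
rewrite /entropy (srw_mean_hk _ xS).
apply: (@le_trans _ _ (\sum_(z <- S) (hk n x z * (ln N - 1) + N^-1))).
  apply: ler_sum => z _.
  have [->|h0] := eqVneq (hk n x z) 0; first by rewrite !mul0r add0r invr_ge0 ltW.
  have hgt0 : 0 < hk n x z by rewrite lt_def h0 hk_ge0.
  have := @ln_le_subr1 R (hk n x z * N)^-1.
  rewrite invr_gt0 mulr_gt0// lnV ?posrE ?mulr_gt0// lnM ?posrE// => /(_ isT) H.
  have := ler_wpM2l (ltW hgt0) H.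
  rewrite [leRHS]mulrBr invfM mulrA mulfV// mul1r mulr1; lra.
rewrite big_split /= -mulr_suml (sum_hk xS) mul1r.
rewrite big_const_seq count_predT iter_addr addr0 -[_ *+ _]mulr_natr.
by rewrite mulVf ?subrK// gt_eqF.
Qed.

Section pairs.
Context (S : {fset nat}).

Local Notation pairs := [seq (y, z) | y <- S, z <- S].

(** The three laws of a pair of positions that are compared below: the walk at
    times [m] and [m + n], the same with the two positions exchanged, and two
    independent walks from [x] at times [m] and [n]. *)
Lemma sum_pairs_fwd m n x (F : nat * nat -> R) :
  (forall z, gball g x (m + n) z -> z \in S) ->
  \sum_(i <- pairs) hk m x i.1 * hk n i.1 i.2 * F i =
  E m (fun y => E n (fun z => F (y, z)) y) x.
Proof.
move=> xS; rewrite big_allpairs /=.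
by rewrite (srw_mean2_hk (fun y z => F (y, z)) xS).
Qed.

Lemma sum_pairs_bwd m n x (F : nat * nat -> R) :
  (forall z, gball g x (m + n) z -> z \in S) ->
  \sum_(i <- pairs) hk m x i.2 * hk n i.2 i.1 * F i =
  E m (fun z => E n (fun y => F (y, z)) z) x.
Proof.
move=> xS; rewrite big_allpairs /= exchange_big.
by rewrite (srw_mean2_hk (fun z y => F (y, z)) xS).
Qed.

Lemma sum_pairs_prod m n x (F : nat * nat -> R) :
  (forall z, gball g x m z -> z \in S) ->
  (forall z, gball g x n z -> z \in S) ->
  \sum_(i <- pairs) hk m x i.1 * hk n x i.2 * F i =
  E m (fun y => E n (fun z => F (y, z)) x) x.
Proof.
move=> xm xn; rewrite big_allpairs /= (srw_mean_hk _ xm).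
apply: eq_bigr => y _; rewrite (srw_mean_hk _ xn) mulr_sumr.
by apply: eq_bigr => z _; rewrite mulrA.
Qed.

End pairs.

(** Mutual information, given the starting point [x], of the positions at
    times [1] and [n.+1]. *)
Definition minfo n x : R := entropy n.+1 x - E 1 (entropy n) x.

Section mutual_information.
Variables (n x : nat).
Let S := fball g x n.+1.
Let pairs := [seq (y, z) | y <- S, z <- S].
Let a (i : nat * nat) : R := hk 1 x i.1 * hk n i.1 i.2.
Let b (i : nat * nat) : R := hk 1 x i.1 * hk n.+1 x i.2.

Let S1 z : gball g x 1 z -> z \in S.
Proof. by move=> xz; apply/in_fball; exact: gball_le xz. Qed.

Let Sn z : gball g x n.+1 z -> z \in S.
Proof. by move/in_fball. Qed.

Let a0 i : 0 <= a i. Proof. by rewrite mulr_ge0 ?hk_ge0. Qed.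
Let b0 i : 0 <= b i. Proof. by rewrite mulr_ge0 ?hk_ge0. Qed.

Let ab0 i : b i = 0 -> a i = 0.
Proof.
move/eqP; rewrite mulf_eq0 => /orP[] /eqP h0; first by rewrite /a h0 mul0r.
by apply/le_anti; rewrite a0 andbT -h0 -add1n; exact: hkD.
Qed.

Let ab1 : \sum_(i <- pairs) a i = \sum_(i <- pairs) b i.
Proof.
under eq_bigr do rewrite -[a _]mulr1.
under [RHS]eq_bigr do rewrite -[b _]mulr1.
by rewrite sum_pairs_fwd// sum_pairs_prod// -(srw_meanD g 1 n) !srw_mean_cst.
Qed.

(** The joint law is compared to the product of its marginals. *)
Lemma kldiv_minfo : kldiv pairs a b = minfo n x.
Proof.
have lnab i : a i * (ln (a i) - ln (b i)) =
    a i * (ln (hk n i.1 i.2) - ln (hk n.+1 x i.2)).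
  have [->|ai0] := eqVneq (a i) 0; first by rewrite !mul0r.
  have : 0 < a i by rewrite lt_def ai0 a0.
  have : 0 < b i by rewrite lt_def b0 andbT; apply: contra_neq ai0; exact: ab0.
  rewrite /a /b; move=> bi ai.
  have h1 : 0 < hk 1 x i.1.
    by rewrite lt_def hk_ge0 andbT; apply: contraTneq ai => ->; rewrite mul0r ltxx.
  rewrite !pmulr_rgt0// in ai bi.
  by rewrite !lnM ?posrE// opprD addrACA subrr add0r.
rewrite /kldiv; under eq_bigr do rewrite lnab.
rewrite sum_pairs_fwd// /minfo -(add1n n) {1}/entropy srw_meanD -srw_mean_sub.
apply: eq_srw_mean => y _; rewrite /entropy -srw_mean_sub.
by apply: eq_srw_mean => z _; rewrite opprK addrC.
Qed.

Lemma minfo_ge0 : 0 <= minfo n x.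
Proof. by rewrite -kldiv_minfo; exact: kldiv_ge0. Qed.

(** Test the joint law of the positions at times [1] and [n.+1] and the product
    of its marginals against [(h y - h x) * (h z - h x)]: as [h] is harmonic,
    the former gives the left-hand side (before squaring) and the latter
    gives [0], so that their closeness bounds the gradient of [h] at [x]. *)
Lemma gradient_le_minfo (h : nat -> R) (K : R) :
  (forall y, gball g x n.+1 y -> srw_step g h y = h y) ->
  (forall y, y \in succs g x -> (h y - h x) ^+ 2 <= K) ->
  E 1 (fun y => (h y - h x) ^+ 2) x ^+ 2 <=
  4 * K * minfo n x * E n.+1 (fun z => (h z - h x) ^+ 2) x.
Proof.
move=> harm hK.
have hn m y k : gball g x k y -> (k + m <= n.+1)%N -> E m h y = h y.
  elim: m y k => [//|m IH] y k xy km; rewrite srw_meanS.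
  rewrite -[RHS]harm; last by apply: gball_le xy; apply: leq_trans km; exact: leq_addr.
  rewrite !srw_stepE; congr (_ / _); rewrite big_seq [RHS]big_seq.
  apply: eq_bigr => w yw; apply: (IH _ (k + 1)%N); last by rewrite -addnA add1n.
  by apply: gball_trans xy _; exact: succs_gball.
set V := E n.+1 _ x.
pose f (i : nat * nat) := (h i.1 - h x) * (h i.2 - h x).
have ha : \sum_(i <- pairs) a i * f i = E 1 (fun y => (h y - h x) ^+ 2) x.
  rewrite sum_pairs_fwd//; apply: eq_srw_mean => y xy.
  rewrite (srw_mean_scale g (h y - h x) (fun z => h z - h x)).
  by rewrite srw_mean_sub srw_mean_cst (hn n y 1%N)// expr2.
have hb : \sum_(i <- pairs) b i * f i = 0.
  rewrite sum_pairs_prod// -[RHS](srw_mean_cst g 0 1 x).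
  apply: eq_srw_mean => y _.
  rewrite (srw_mean_scale g (h y - h x) (fun z => h z - h x)).
  rewrite srw_mean_sub srw_mean_cst.
  by rewrite (hn n.+1 x 0%N) ?subrr ?mulr0//; exact: gball_refl.
have := pinsker a0 b0 ab0 ab1 f.
under eq_bigr do rewrite mulrBl.
rewrite sumrB ha hb subr0 kldiv_minfo => /le_trans; apply.
have -> : 4 * K * minfo n x * V = 2 * minfo n x * (K * (V + V)) by lra.
apply: ler_wpM2l; first by rewrite mulr_ge0// minfo_ge0.
have aV : \sum_(i <- pairs) a i * (h i.2 - h x) ^+ 2 = V.
  by rewrite sum_pairs_fwd// -(srw_meanD g 1 n).
have bV : \sum_(i <- pairs) b i * (h i.2 - h x) ^+ 2 = V.
  by rewrite sum_pairs_prod// (srw_mean_cst g V).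
rewrite -{1}aV -bV -big_split mulr_sumr /=.
apply: ler_sum => -[y z] _; rewrite -mulrDl [leRHS]mulrCA.
have [hy|hy] := eqVneq (hk 1 x y) 0.
  by rewrite /a /b [hk 1 x _]hy !mul0r addr0 !mul0r.
rewrite /f exprMn; apply: ler_wpM2l; first exact: addr_ge0.
apply: ler_wpM2r; first exact: sqr_ge0.
by apply: hK; rewrite -(@hk1_gt0 R g) lt_def hy hk_ge0.
Qed.



End mutual_information.



(** Adding the mean logarithm of the reversible measure turns the increments of
    the entropy into relative entropies, see [kldiv_revinfo]. *)
Definition weighted_entropy n x : R :=
  entropy n x + E n (fun z => ln (size (succs g z))%:R) x.

(** Relative entropy of the law of the positions at times [(n, n.+1)] with respect
    to the law of the positions at times [(n.+2, n.+1)]. *)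
Definition revinfo n x : R := weighted_entropy n.+1 x - weighted_entropy n x.

(** The distance is shifted by one so that its increments over a step are bounded
    by multiples of itself. *)
Definition second_moment n x : R := E n (fun z => (gdist g x z).+1%:R ^+ 2) x.

Section time_reversal.
Variables (n x : nat).
Let S := fball g x n.+2.
Let pairs := [seq (y, z) | y <- S, z <- S].
Let a (i : nat * nat) : R := hk n x i.1 * hk 1 i.1 i.2.
Let b (i : nat * nat) : R := hk n.+1 x i.2 * hk 1 i.2 i.1.

Let Sn1 z : gball g x (n + 1) z -> z \in S.
Proof. by move=> xz; apply/in_fball; apply: gball_le xz; rewrite addn1. Qed.

Let Sn2 z : gball g x (n.+1 + 1) z -> z \in S.
Proof. by move=> xz; apply/in_fball; rewrite addn1 in xz. Qed.

Let a0 i : 0 <= a i. Proof. by rewrite mulr_ge0 ?hk_ge0. Qed.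
Let b0 i : 0 <= b i. Proof. by rewrite mulr_ge0 ?hk_ge0. Qed.

Let hk1_sym0 y z : hk 1 y z = 0 -> hk 1 z y = 0.
Proof. by rewrite !hk1E succs_sym; case: (_ \in _); rewrite ?mul0r// mul1r => /eqP;
  rewrite invr_eq0 pnatr_eq0 eqn0Ngt size_succs_gt0. Qed.

Let ab0 i : b i = 0 -> a i = 0.
Proof.
move/eqP; rewrite mulf_eq0 => /orP[] /eqP h0; last first.
  by rewrite /a hk1_sym0// mulr0.
by apply/le_anti; rewrite a0 andbT -h0 -addn1; exact: hkD.
Qed.

Let ab1 : \sum_(i <- pairs) a i = \sum_(i <- pairs) b i.
Proof.
under eq_bigr do rewrite -[a _]mulr1.
under [RHS]eq_bigr do rewrite -[b _]mulr1.
rewrite sum_pairs_fwd// sum_pairs_bwd//.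
by rewrite -(srw_meanD g n 1) -(srw_meanD g n.+1 1) !srw_mean_cst.
Qed.

Let lnw z : R := ln (size (succs g z))%:R.

(** By reversibility [hk 1 y z / hk 1 z y] is a ratio of values of the reversible
    measure, so that the logarithm of the ratio of the two laws splits into a
    function of the position at time [n] and one of the position at [n.+1]. *)
Lemma kldiv_revinfo : kldiv pairs a b = revinfo n x.
Proof.
have lnab i : a i * (ln (a i) - ln (b i)) =
    a i * (ln (hk n x i.1) - lnw i.1 + (lnw i.2 - ln (hk n.+1 x i.2))).
  have [->|ai0] := eqVneq (a i) 0; first by rewrite !mul0r.
  have : 0 < a i by rewrite lt_def ai0 a0.
  have : 0 < b i by rewrite lt_def b0 andbT; apply: contra_neq ai0; exact: ab0.
  case: i {ai0} => y z; rewrite /a /b [(y, z).1]/= [(y, z).2]/= => bi ai.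
  congr (_ * _).
  have hy : 0 < hk n x y.
    by rewrite lt_def hk_ge0 andbT; apply: contraTneq ai => ->; rewrite mul0r ltxx.
  have hz : 0 < hk n.+1 x z.
    by rewrite lt_def hk_ge0 andbT; apply: contraTneq bi => ->; rewrite mul0r ltxx.
  rewrite !pmulr_rgt0// in ai bi.
  have w0 u : 0 < (size (succs g u))%:R :> R by rewrite ltr0n size_succs_gt0.
  have := congr1 (@ln R) (hk1_reversible g y z).
  rewrite !lnM ?posrE// -/(lnw y) -/(lnw z); lra.
rewrite /kldiv; under eq_bigr do rewrite lnab.
rewrite sum_pairs_fwd// /revinfo /weighted_entropy.
have FE m : entropy m x + E m lnw x = E m (fun z => lnw z - ln (hk m x z)) x.
  by rewrite addrC -srw_mean_add.
rewrite -/lnw !FE -[in E n.+1 _ x](addn1 n) srw_meanD addn1 -srw_mean_sub.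
apply: eq_srw_mean => y _.
rewrite (srw_mean_add g (fun=> ln (hk n x y) - lnw y)).
by rewrite srw_mean_cst addrC opprB.
Qed.

Lemma revinfo_ge0 : 0 <= revinfo n x.
Proof. by rewrite -kldiv_revinfo; exact: kldiv_ge0. Qed.

(** From its position at time [n.+1] the walk steps back to time [n] and forward to
    time [n.+2] in nearly the same way.  The test function is the change of the
    squared distance along this step: its mean under one law is
    [second_moment n.+1 - second_moment n], and under the other
    [second_moment n.+1 - second_moment n.+2]. *)
Lemma second_moment_step :
  (second_moment n.+2 x - second_moment n x) ^+ 2 <=
  36 * revinfo n x * second_moment n.+1 x.
Proof.
pose w z : R := (gdist g x z).+1%:R ^+ 2.
pose f (i : nat * nat) := w i.2 - w i.1.
have D2 m : second_moment m x = E m w x by [].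
have ha : \sum_(i <- pairs) a i * f i = second_moment n.+1 x - second_moment n x.
  rewrite sum_pairs_fwd// !D2 -(addn1 n) srw_meanD -srw_mean_sub.
  apply: eq_srw_mean => y _.
  by rewrite (srw_mean_sub g w (fun=> w y)) srw_mean_cst.
have hb : \sum_(i <- pairs) b i * f i = second_moment n.+1 x - second_moment n.+2 x.
  rewrite sum_pairs_bwd// !D2 -(addn1 n.+1) srw_meanD -srw_mean_sub.
  apply: eq_srw_mean => z _.
  by rewrite (srw_mean_sub g (fun=> w z) w) srw_mean_cst.
have := pinsker a0 b0 ab0 ab1 f.
under eq_bigr do rewrite mulrBl.
rewrite sumrB ha hb kldiv_revinfo opprB addrC addrA subrK => /le_trans; apply.
have -> : 36 * revinfo n x * second_moment n.+1 x =
    2 * revinfo n x * (9 * (second_moment n.+1 x + second_moment n.+1 x)) by lra.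
apply: ler_wpM2l; first by rewrite mulr_ge0// revinfo_ge0.
have aV : \sum_(i <- pairs) a i * w i.2 = second_moment n.+1 x.
  by rewrite sum_pairs_fwd// D2 -(addn1 n) srw_meanD.
have bV : \sum_(i <- pairs) b i * w i.2 = second_moment n.+1 x.
  rewrite sum_pairs_bwd// D2; apply: eq_srw_mean => z _.
  exact: (srw_mean_cst g (w z) 1 z).
rewrite -{1}aV -bV -big_split mulr_sumr /=.
apply: ler_sum => -[y z] _; rewrite -mulrDl [leRHS]mulrCA.
have [->|ab_neq0] := eqVneq (a (y, z) + b (y, z)) 0; first by rewrite !mul0r.
apply: ler_wpM2l; first exact: addr_ge0.
(* Under either law the two positions are reachable and at most one step apart. *)
have [xy xz yz] : [/\ reachable g x y, reachable g x z & z \in succs g y].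
  have [a_eq0|] := eqVneq (a (y, z)) 0; last first.
    rewrite /a mulf_eq0 negb_or /= => /andP[hy hyz].
    have zy : z \in succs g y by rewrite -(@hk1_gt0 R g) lt_def hyz hk_ge0.
    have xy : gball g x n y by apply: contra_neqP hy; exact: hk_eq0.
    split=> //; first exact: xy.1.
    exact: (gball_trans xy (succs_gball zy)).1.
  move: ab_neq0; rewrite a_eq0 add0r /b mulf_eq0 negb_or /= => /andP[hz hzy].
  have yz : y \in succs g z by rewrite -(@hk1_gt0 R g) lt_def hzy hk_ge0.
  have xz : gball g x n.+1 z by apply: contra_neqP hz; exact: hk_eq0.
  split; [exact: (gball_trans xz (succs_gball yz)).1 | exact: xz.1 |].
  by rewrite succs_sym.
have := gdist_step xy (succs_gball yz).
rewrite succs_sym in yz; have := gdist_step xz (succs_gball yz).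
rewrite /f /w /= -!(ler_nat R) -!(natr1 _).
have : 0 <= (gdist g x y)%:R :> R by [].
have : 0 <= (gdist g x z)%:R :> R by [].
move: (gdist g x y)%:R (gdist g x z)%:R => u v u0 v0 uv vu.
have -> : (v + 1) ^+ 2 - (u + 1) ^+ 2 = (v - u) * (v + u + 2) by lra.
rewrite exprMn; apply: (@le_trans _ _ ((v + u + 2) ^+ 2)); last by nra.
by apply: ler_piMl; [exact: sqr_ge0 | nra].
Qed.

End time_reversal.

(** Telescoping [revinfo] leaves the weighted entropy, to which the number of
    vertices within reach gives a bound. *)
Lemma sum_revinfo_le N x :
  \sum_(n < N) revinfo n x <= 2 * ln (card_gball g x N.+1)%:R.
Proof.
rewrite -(big_mkord xpredT (revinfo^~ x)) telescope_sumr//.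
have T0 : 0 <= weighted_entropy 0 x.
  by apply: addr_ge0; [exact: entropy_ge0 | apply: ln_ge0; rewrite ler1n size_succs_gt0].
apply: (@le_trans _ _ (weighted_entropy N x)); first by rewrite gerBl.
rewrite mulr_natl mulr2n; apply: lerD.
  apply: le_trans (entropy_le _ _) _.
  by rewrite ler_ln ?posrE ?ltr0n ?card_gball_gt0// ler_nat card_gball_le.
rewrite -(srw_mean_cst g (ln (card_gball g x N.+1)%:R) N x).
apply: srw_mean_le => y xy.
rewrite ler_ln ?posrE ?ltr0n ?size_succs_gt0 ?card_gball_gt0// ler_nat.
apply: uniq_leq_size => [|z yz]; first exact: succs_uniq.
by apply/in_fball; rewrite -addn1; apply: gball_trans xy _; exact: succs_gball.
Qed.

(** Dividing [second_moment_step] by the square root of the second moment gives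
    the increments of that square root. *)
Lemma second_moment_le n x :
  second_moment n.+1 x <= (2 + 3 * \sum_(k < n) Num.sqrt (revinfo k x)) ^+ 2.
Proof.
have dist0 y m : gball g x m y -> ((gdist g x y).+1%:R ^+ 2 <= m.+1%:R ^+ 2 :> R).
  by move=> [_ xy]; rewrite -!natrX ler_nat leq_exp2r.
have D_le m : second_moment m x <= m.+1%:R ^+ 2.
  by rewrite -(srw_mean_cst g (m.+1%:R ^+ 2) m x); apply: srw_mean_le => y /dist0.
have D_ge0 m : 0 <= second_moment m x by apply: srw_mean_ge0 => y _; exact: sqr_ge0.
suff : second_moment n x <= (2 + 3 * \sum_(k < n) Num.sqrt (revinfo k x)) ^+ 2 /\
    second_moment n.+1 x <= (2 + 3 * \sum_(k < n) Num.sqrt (revinfo k x)) ^+ 2.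
  by case.
pose S m := \sum_(k < m) Num.sqrt (revinfo k x).
rewrite -/(S n); elim: n => [|n [IH0 IH1]].
  rewrite /S big_ord0 mulr0 addr0; split; last exact: D_le.
  by apply: le_trans (D_le 0%N) _; rewrite expr1n; lra.
have -> : S n.+1 = S n + Num.sqrt (revinfo n x) by rewrite /S big_ord_recr.
have S0 : 0 <= S n by apply: sumr_ge0 => k _; exact: sqrtr_ge0.
have t0 := sqrtr_ge0 (revinfo n x); have tE := sqr_sqrtr (revinfo_ge0 n x).
have step := second_moment_step n x; rewrite -tE in step.
move: (Num.sqrt _) (S n) (second_moment _ x) (second_moment n.+1 x)
  (second_moment n.+2 x) S0 t0 IH0 IH1 (D_ge0 n.+1) step {tE}.
move=> t s d0 d1 d2 s0 t0 IH0 IH1 d10 step.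
split; first by nra.
have {}step : (d2 - d0) ^+ 2 <= (6 * t * (2 + 3 * s)) ^+ 2.
  apply: le_trans step _; rewrite [leRHS]exprMn exprMn (_ : 36 = 6 ^+ 2); last by lra.
  by apply: ler_wpM2l => //; rewrite mulr_ge0 ?sqr_ge0.
suff : d2 - d0 <= 6 * t * (2 + 3 * s) by nra.
have : 0 <= 6 * t * (2 + 3 * s) by nra.
move: (6 * t * _) (d2 - d0) step => u v; have [//|] := lerP v u; nra.
Qed.
End walk_entropy.

(** * Scales at which two sequences of information are small *)

Section good_scales.
Context {R : realType}.

(** Harmonic numbers, the clock in which logarithmic growth is linear. *)
Definition hsum (N : nat) : R := \sum_(k < N) k.+1%:R^-1.

Lemma hsumS N : hsum N.+1 = hsum N + N.+1%:R^-1.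
Proof. by rewrite /hsum big_ord_recr. Qed.

Lemma hsum_le m n : (m <= n)%N -> hsum m <= hsum n.
Proof.
move=> /subnKC <-; elim: (n - m)%N => [|k IH]; first by rewrite addn0.
by rewrite addnS hsumS; apply: le_trans IH _; rewrite lerDl invr_ge0.
Qed.

Lemma ln_le_hsum N : ln N.+1%:R <= hsum N.
Proof.
elim: N => [|N IH]; first by rewrite ln1 /hsum big_ord0.
rewrite hsumS -(subrK (ln N.+1%:R) (ln _)) addrC; apply: lerD => //.
rewrite -ln_div ?posrE//.
have -> : N.+2%:R / N.+1%:R = 1 + N.+1%:R^-1 :> R.
  by rewrite -[N.+2]addn1 natrD mulrDl mul1r mulfV.
by apply: le_ln1Dx; apply: (@lt_le_trans _ _ 0); rewrite ?invr_ge0//; lra.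
Qed.

Lemma hsum_unbounded (M : R) : exists N, forall n, (N <= n)%N -> M < hsum n.
Proof.
exists (Num.bound (expR M)) => n Nn.
apply: lt_le_trans (ln_le_hsum n); rewrite -[ltLHS]expRK ltr_ln ?posrE ?expR_gt0//.
apply: lt_le_trans (archi_boundP (expR_ge0 M)) _.
by rewrite ler_nat; exact: leq_trans (leqnSn n).
Qed.

(** A Hardy inequality.  Bounding the tail sums of [n^(-3/2)] amounts to
    carrying the last term of the left-hand side through an induction. *)
Lemma hardy_sqrt (t : nat -> R) N : (forall k, 0 <= t k) ->
  \sum_(n < N) (\sum_(k < n.+1) t k) / (n.+1%:R * Num.sqrt n.+1%:R) <=
  \sum_(k < N) 3 * (t k / Num.sqrt k.+1%:R).
Proof.
move=> t0.
have s0 n : 0 <= \sum_(k < n) t k by apply: sumr_ge0.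
suff : \sum_(n < N) (\sum_(k < n.+1) t k) / (n.+1%:R * Num.sqrt n.+1%:R) +
    2 * (\sum_(k < N) t k) / Num.sqrt N%:R <=
    \sum_(k < N) 3 * (t k / Num.sqrt k.+1%:R).
  by apply: le_trans; rewrite lerDl divr_ge0 ?sqrtr_ge0 ?mulr_ge0.
elim: N => [|N IH]; first by rewrite !big_ord0 mulr0 mul0r addr0.
rewrite big_ord_recr [in leRHS]big_ord_recr /=.
suff : (\sum_(k < N.+1) t k) / (N.+1%:R * Num.sqrt N.+1%:R) +
    2 * (\sum_(k < N.+1) t k) / Num.sqrt N.+1%:R <=
    2 * (\sum_(k < N) t k) / Num.sqrt N%:R + 3 * (t N / Num.sqrt N.+1%:R).
  move=> step; rewrite -addrA; apply: le_trans (lerD (lexx _) step) _.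
  by rewrite addrA lerD2r.
rewrite big_ord_recr/=; move: (s0 N) (t0 N).
case: N {IH} => [|N].
  by rewrite big_ord0 sqrtr1 mulr1 divr1 mulr0 mul0r; lra.
move: (\sum_(k < N.+1) t k) (t N.+1) => s u {}s0 {}u0.
set p : R := Num.sqrt N.+1%:R; set q : R := Num.sqrt N.+2%:R.
have p0 : 0 < p by rewrite sqrtr_gt0 ltr0n.
have q1 : 1 <= q by rewrite -[leLHS]sqrtr1 ler_wsqrtr// ler1n.
have q0 : 0 < q by exact: lt_le_trans q1.
have qq : N.+2%:R = q ^+ 2 by rewrite sqr_sqrtr.
have pp : N.+1%:R = p ^+ 2 by rewrite sqr_sqrtr.
have pq : q ^+ 2 = p ^+ 2 + 1 by rewrite -qq -pp natr1.
rewrite qq !invfM.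
have : q^-1 <= 1 by rewrite invf_le1.
have : 0 < p^-1 by rewrite invr_gt0.
have : 0 < q^-1 by rewrite invr_gt0.
have : p^-1 ^+ 2 = q^-1 ^+ 2 + p^-1 ^+ 2 * q^-1 ^+ 2.
  have a2 : p^-1 ^+ 2 * p ^+ 2 = 1 by rewrite -exprMn mulVf ?gt_eqF// expr1n.
  have b2 : q^-1 ^+ 2 * q ^+ 2 = 1 by rewrite -exprMn mulVf ?gt_eqF// expr1n.
  have : p^-1 ^+ 2 * (q^-1 ^+ 2 * q ^+ 2) = q^-1 ^+ 2 * (p^-1 ^+ 2 * p ^+ 2 + p^-1 ^+ 2).
    by rewrite pq mulrCA; congr (_ * _); rewrite mulrDr mulr1.
  by rewrite a2 b2 mulr1 mulrDr mulr1 (mulrC (p^-1 ^+ 2)).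
move: (p^-1) (q^-1) => a b ab b0 a0 b1.
have b3 : b ^+ 3 <= 2 * (a - b).
  rewrite -subr_ge0 -(pmulr_rge0 _ (addr_gt0 a0 b0)).
  have -> : (a + b) * (2 * (a - b) - b ^+ 3) =
      2 * (a ^+ 2 - b ^+ 2) - b ^+ 3 * (a + b) by lra.
  have le_ba : b <= a by nra.
  have -> : 2 * (a ^+ 2 - b ^+ 2) - b ^+ 3 * (a + b) =
      b ^+ 2 * ((a - b) * (2 * a + b)) by nra.
  by rewrite mulr_ge0 ?sqr_ge0// mulr_ge0//; lra.
have -> : (s + u) * (b * b * b) = s * b ^+ 3 + u * b ^+ 3 by lra.
have : s * b ^+ 3 <= s * (2 * (a - b)) by exact: ler_wpM2l.
have : b ^+ 3 <= b by nra.
move=> /(ler_wpM2l u0); lra.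
Qed.


(** If [u] and [t] had no good common scale beyond [n0], then [K / n.+1] would be
    at most [u n + (\sum_(k < n.+1) Num.sqrt (t k)) / n.+1 ^ (3/2)] for all
    [n >= n0]; summing over [n], the Hardy inequality and
    [2 * Num.sqrt (t k) / Num.sqrt k.+1 <= t k + k.+1^-1] bound the harmonic
    numbers. *)
Lemma good_scale (u t : nat -> R) (C : R) :
  (forall n, 0 <= u n) -> (forall n, 0 <= t n) ->
  (forall N0, exists2 N, (N0 <= N)%N &
    \sum_(n < N) u n + \sum_(n < N) t n <= C * hsum N) ->
  exists2 K, 0 <= K & forall n0, exists n, [/\ (n0 <= n)%N, u n <= K / n.+1%:R &
    \sum_(k < n) Num.sqrt (t k) <= K * Num.sqrt n.+1%:R].
Proof.
move=> u0 t0 utC.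
have C0 : 0 <= C.
  have [N N1] := utC 1%N; have [//|C0] := lerP 0 C; rewrite leNgt => /negP[].
  have hN : 0 < hsum N.
    by apply: lt_le_trans (hsum_le N1); rewrite hsumS /hsum big_ord0; lra.
  by apply: (@lt_le_trans _ _ 0); rewrite ?addr_ge0 ?sumr_ge0// pmulr_llt0.
pose K := 2 * C + 4; exists K; first by rewrite /K; lra.
move=> n0; apply: contrapT => bad.
pose S n := \sum_(k < n) Num.sqrt (t k).
have S_le n : S n <= S n.+1 by rewrite /S big_ord_recr /= lerDl sqrtr_ge0.
have S0 n : 0 <= S n by apply: sumr_ge0 => k _; exact: sqrtr_ge0.
have step n : (n0 <= n)%N ->
    K / n.+1%:R <= u n + S n.+1 / (n.+1%:R * Num.sqrt n.+1%:R).
  move=> n0n; have n1 : 0 < n.+1%:R :> R by [].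
  have [un|un] := lerP (u n) (K / n.+1%:R); last first.
    by apply: (le_trans (ltW un)); rewrite lerDl divr_ge0// mulr_ge0// sqrtr_ge0.
  have [Sn|Sn] := lerP (S n) (K * Num.sqrt n.+1%:R).
    by case: bad; exists n.
  apply: (@le_trans _ _ (S n.+1 / (n.+1%:R * Num.sqrt n.+1%:R))); last by rewrite lerDr.
  rewrite ler_pdivlMr ?mulr_gt0 ?sqrtr_gt0//.
  rewrite mulrA divfK ?gt_eqF//; apply: le_trans (S_le n); exact: ltW.
have key N : (n0 <= N)%N -> K * hsum N <= K * hsum n0 +
    (\sum_(n < N) u n + \sum_(n < N) S n.+1 / (n.+1%:R * Num.sqrt n.+1%:R)).
  move=> /subnKC <-; elim: (N - n0)%N => [|m IH].
    rewrite addn0 lerDl addr_ge0 ?sumr_ge0// => n _.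
    by rewrite divr_ge0// mulr_ge0// sqrtr_ge0.
  rewrite addnS hsumS !big_ord_recr /= mulrDr.
  rewrite [leRHS](_ : _ = K * hsum n0 + (\sum_(n < n0 + m) u n +
      \sum_(n < n0 + m) S n.+1 / (n.+1%:R * Num.sqrt n.+1%:R)) +
      (u (n0 + m)%N + S (n0 + m).+1 / ((n0 + m).+1%:R * Num.sqrt (n0 + m).+1%:R))).
    exact: lerD IH (step _ (leq_addr _ _)).
  by rewrite -[RHS]addrA; congr (_ + _); rewrite addrACA.
have [N1 hN1] := hsum_unbounded (K * hsum n0).
have [N] := utC (maxn N1 n0); rewrite geq_max => /andP[NN1 Nn0] utN.
have := key N Nn0; have := hN1 N NN1.
have : \sum_(n < N) S n.+1 / (n.+1%:R * Num.sqrt n.+1%:R) <=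
    2 * (\sum_(k < N) t k) + 2 * hsum N.
  apply: le_trans (hardy_sqrt N (fun k => sqrtr_ge0 (t k))) _.
  rewrite /hsum 2!mulr_sumr -big_split/=; apply: ler_sum => k _.
  have := sqr_sqrtr (t0 k); have := sqrtr_ge0 (t k).
  have : (Num.sqrt k.+1%:R)^-1 ^+ 2 = k.+1%:R^-1 :> R by rewrite exprVn sqr_sqrtr.
  have : 0 <= (Num.sqrt k.+1%:R)^-1 :> R by rewrite invr_ge0 sqrtr_ge0.
  move: (_^-1) (Num.sqrt (t k)) => a b a0 <- b0 <-.
  by have := sqr_ge0 (a - b); nra.
have : 0 <= \sum_(n < N) u n by apply: sumr_ge0.
have : 0 <= \sum_(n < N) t n by apply: sumr_ge0.
have : 0 <= hsum N by apply: sumr_ge0 => k _; rewrite invr_ge0.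
move: utN {hN1}; set A := \sum_(n < N) u n; set T := \sum_(n < N) t n.
set B := \sum_(n < N) _ / _; set K0 := K * hsum n0; rewrite /K.
by move: (hsum N) A T B K0; move=> h A T B K0; nra.
Qed.

End good_scales.

(** * Harmonic functions on a fixed graph *)

Section quenched_liouville.
Context {R : realType} (g : graph).

(** A common bound for the sums up to [N] of the two kinds of information: the
    second term dominates the sum of [revinfo], see [sum_revinfo_le]. *)
Definition info_growth (N x : nat) : R :=
  \sum_(n < N) minfo g n x + 2 * ln (card_gball g x N.+1)%:R.

(** At a good scale [n] the information [minfo n] is [O(1 / n)], while the walk is
    diffusive, so that a sublinear [h] has variance [o(n)] at time [n]: the bound
    of [gradient_le_minfo] tends to [0]. *)
Lemma gradient_eq0 (x : nat) (h : nat -> R) :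
  (forall y, reachable g x y -> srw_step g h y = h y) ->
  (forall e, 0 < e -> exists C, forall z, reachable g x z ->
    (h z - h x) ^+ 2 <= e * (gdist g x z).+1%:R ^+ 2 + C) ->
  (exists C, forall N0, exists2 N, (N0 <= N)%N & info_growth N x <= C * hsum N) ->
  forall y, y \in succs g x -> h y = h x.
Proof.
move=> harm sublin [C0 infoC].
have [K K0 goodK] : exists2 K : R, 0 <= K & forall n0, exists n, [/\ (n0 <= n)%N,
    minfo g n x <= K / n.+1%:R &
    \sum_(k < n) Num.sqrt (revinfo g k x) <= K * Num.sqrt n.+1%:R].
  apply: (@good_scale R (minfo g ^~ x) (revinfo g ^~ x) C0).
  - by move=> n; exact: minfo_ge0.
  - by move=> n; exact: revinfo_ge0.
  move=> N0; have [N N0N infoN] := infoC N0; exists N => //.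
  by apply: le_trans infoN; apply: lerD => //; exact: sum_revinfo_le.
pose A := \sum_(y <- succs g x) (h y - h x) ^+ 2.
have A0 : 0 <= A by apply: sumr_ge0 => y _; exact: sqr_ge0.
have hA y : y \in succs g x -> (h y - h x) ^+ 2 <= A.
  move=> xy; rewrite /A (bigD1_seq y) ?succs_uniq//= lerDl.
  by apply: sumr_ge0 => z _; exact: sqr_ge0.
pose D := srw_mean g 1 (fun y => (h y - h x) ^+ 2) x.
have D0 : 0 <= D by apply: srw_mean_ge0 => y _; exact: sqr_ge0.
pose B := 4 * A * K * ((2 + 3 * K) ^+ 2 + 1).
have B0 : 0 <= B by rewrite !mulr_ge0// addr_ge0// sqr_ge0.
have DB e : 0 < e -> D ^+ 2 <= B * e.
  move=> e0; have [C hC] := sublin e e0.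
  have [n [n0 un tn]] := goodK (Num.bound `|C / e|).
  pose V := srw_mean g n.+1 (fun z => (h z - h x) ^+ 2) x.
  have V0 : 0 <= V by apply: srw_mean_ge0 => y _; exact: sqr_ge0.
  have D2 : D ^+ 2 <= 4 * A * minfo g n x * V.
    by apply: gradient_le_minfo => // y xy; apply: harm; exact: xy.1.
  have n1 : 0 < n.+1%:R :> R by [].
  have Cn : C <= e * n.+1%:R.
    rewrite mulrC -ler_pdivrMr//; apply: le_trans (ler_norm _) _.
    apply: le_trans (ltW (archi_boundP (normr_ge0 _))) _.
    by rewrite ler_nat; exact: leq_trans (leqnSn n).
  have VD : V <= e * second_moment g n.+1 x + C.
    rewrite -srw_mean_scale -(srw_mean_cst g C n.+1 x) -srw_mean_add.
    by apply: srw_mean_le => z xz; apply: hC; exact: xz.1.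
  have : second_moment g n.+1 x <= (2 + 3 * K) ^+ 2 * n.+1%:R :> R.
    apply: le_trans (second_moment_le _ _ _) _.
    have : 1 <= Num.sqrt n.+1%:R :> R by rewrite -[leLHS]sqrtr1 ler_wsqrtr// ler1n.
    have : Num.sqrt n.+1%:R ^+ 2 = n.+1%:R :> R by rewrite sqr_sqrtr.
    move: tn; set S := \sum_(k < n) _.
    have : 0 <= S by apply: sumr_ge0 => k _; exact: sqrtr_ge0.
    move: S (Num.sqrt n.+1%:R) => S r S0 Sr <- r1.
    rewrite -exprMn ler_sqr ?nnegrE; nra.
  move: (second_moment g n.+1 x) VD => M VD MK.
  have {}VD : V <= ((2 + 3 * K) ^+ 2 + 1) * e * n.+1%:R by nra.
  apply: (le_trans D2); apply: (@le_trans _ _ (4 * A * (K / n.+1%:R) *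
      (((2 + 3 * K) ^+ 2 + 1) * e * n.+1%:R))).
    apply: ler_pM => //; rewrite ?mulr_ge0 ?minfo_ge0//.
    by apply: ler_wpM2l => //; rewrite mulr_ge0.
  rewrite /B; have pq : n.+1%:R^-1 * n.+1%:R = 1 :> R by rewrite mulVf.
  move: (n.+1%:R : R) pq => q; move: (q^-1) => p pq.
  rewrite [leLHS](_ : _ = 4 * A * K * ((2 + 3 * K) ^+ 2 + 1) * e * (p * q)); last by lra.
  by rewrite pq mulr1.
have {}D0 : D = 0.
  apply/eqP; rewrite -sqrf_eq0; apply/eqP/le_anti; rewrite sqr_ge0 andbT.
  apply/ler_addgt0Pr => e e0; rewrite add0r.
  apply: (le_trans (DB (e / (B + 1)) _)); first by rewrite divr_gt0// ltr_wpDl.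
  rewrite mulrA ler_pdivrMr ?ltr_wpDl//; nra.
move=> y xy; apply/eqP; rewrite -subr_eq0 -sqrf_eq0; apply/eqP.
move/eqP: D0; rewrite /D srw_meanS srw_stepE mulf_eq0 invr_eq0 pnatr_eq0.
rewrite eqn0Ngt size_succs_gt0 orbF psumr_eq0 => [/allP/(_ y xy)/eqP|z _].
  by [].
exact: sqr_ge0.
Qed.

End quenched_liouville.

(** * Functions of a rooted ball *)

Section ball_isomorphisms.
Implicit Types (r k m n : nat).

Lemma reachable_vertex (g : graph) x y : vertex g x -> reachable g x y -> vertex g y.
Proof.
move=> gx [[/walk0<-//|n]] /walkSr[z _].
by rewrite adj_sym; exact: adj_vertex.
Qed.

Lemma rerootE (g : rooted_graph) x : vertex g x ->
  rg_graph (reroot g x) = g /\ rg_root (reroot g x) = x.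
Proof. by move=> gx; rewrite /reroot; case: pselect. Qed.

Section transport.
Variables (r : nat) (g g' : rooted_graph) (phi : nat -> nat).
Hypothesis phi_bij : set_bij (gball g (rg_root g) r) (gball g' (rg_root g') r) phi.
Hypothesis phi_root : phi (rg_root g) = rg_root g'.
Hypothesis phi_adj : forall x y, gball g (rg_root g) r x ->
  gball g (rg_root g) r y -> adj g x y = adj g' (phi x) (phi y).

Let o := rg_root g.

Let phi_inj : {in gball g o r &, injective phi}.
Proof. exact: set_bij_inj phi_bij. Qed.

Lemma walk_transport k n x y : gball g o k x -> (k + n <= r)%N ->
  walk g n x y -> walk g' n (phi x) (phi y).
Proof.
elim: n k x => [k x _ _ /walk0->|n IH k x ox kn /walkS[z xz zy]]; first exact/walk0.
have oz : gball g o (k + 1) z by apply: gball_trans ox _; exact: gball_adj.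
apply/walkS; exists (phi z); last by apply: IH oz _ zy; rewrite addn1 addSnnS.
rewrite -phi_adj//; first by apply: gball_le ox; exact: leq_trans (leq_addr _ _) kn.
by apply: gball_le oz; apply: leq_trans kn; rewrite leq_add2l.
Qed.

Lemma gball_transport k x : gball g o k x -> (k <= r)%N ->
  gball g' (rg_root g') k (phi x).
Proof.
move=> /gballP[n nk ox] kr; apply/gballP; exists n => //.
rewrite -phi_root; apply: (walk_transport (gball_refl _ _ 0)) ox.
by rewrite add0n; exact: leq_trans kr.
Qed.

(** An edge from the image of an interior vertex of the ball leads to a vertex of
    the target ball, hence to the image of a vertex. *)
Lemma adj_lift k x y' : gball g o k x -> (k < r)%N -> adj g' (phi x) y' ->
  exists2 y, adj g x y & y' = phi y.
Proof.
move=> ox kr xy'.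
have oy' : gball g' (rg_root g') r y'.
  apply: (@gball_le _ _ _ _ kr); rewrite -addn1; apply: gball_trans (gball_adj xy').
  by apply: gball_transport => //; exact: ltnW.
have [y oy yy'] := set_bij_surj phi_bij oy'.
exists y => //; rewrite phi_adj// ?yy'//.
by apply: gball_le ox; exact: ltnW.
Qed.

Lemma walk_lift k n x y' : gball g o k x -> (k + n <= r)%N ->
  walk g' n (phi x) y' -> exists2 y, walk g n x y & y' = phi y.
Proof.
elim: n k x => [k x _ _ /walk0<-|n IH k x ox kn /walkS[z' xz' zy']].
  by exists x => //; exact/walk0.
have kr : (k < r)%N by apply: leq_trans kn; rewrite addnS ltnS leq_addr.
have [z xz zE] := adj_lift ox kr xz'.
have oz : gball g o (k + 1) z by apply: gball_trans ox _; exact: gball_adj.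
rewrite zE in zy'; have [|y zy yE] := IH _ z oz _ zy'; first by rewrite addn1 addSnnS.
by exists y => //; apply/walkS; exists z.
Qed.

Lemma succs_transport k x : gball g o k x -> (k < r)%N ->
  perm_eq (succs g' (phi x)) (map phi (succs g x)).
Proof.
move=> ox kr.
have nbrs_perm : perm_eq (nbrs g' (phi x)) (map phi (nbrs g x)).
  apply: uniq_perm; first exact: fset_uniq.
    rewrite map_inj_in_uniq ?fset_uniq// => y z; rewrite !in_nbrs => xy xz.
    have ball_nbr w : adj g x w -> w \in gball g o r.
      move=> xw; rewrite inE; apply: (@gball_le _ _ _ _ kr); rewrite -addn1.
      by apply: gball_trans ox _; exact: gball_adj.
    by apply: phi_inj; exact: ball_nbr.
  move=> y'; rewrite in_nbrs; apply/idP/mapP => [xy'|[y]].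
    by have [y xy yE] := adj_lift ox kr xy'; exists y => //; rewrite in_nbrs.
  rewrite in_nbrs => xy ->; rewrite -phi_adj//; first by apply: gball_le ox; exact: ltnW.
  apply: (@gball_le _ _ _ _ kr); rewrite -addn1.
  by apply: gball_trans ox _; exact: gball_adj.
have degE : deg g' (phi x) = deg g x.
  by rewrite /deg (perm_size nbrs_perm) size_map.
by rewrite /succs degE; case: ifP.
Qed.

Lemma srw_mean_transport (R : realType) n (f f' : nat -> R) : (n <= r)%N ->
  (forall z, gball g o n z -> f z = f' (phi z)) ->
  srw_mean g n f o = srw_mean g' n f' (rg_root g').
Proof.
elim: n f f' => [f f' _ ff'|n IH f f' nr ff'].
  by rewrite /srw_mean /= -phi_root; apply: ff'; exact: gball_refl.
rewrite -addn1 !srw_meanD; apply: IH; first exact: ltnW.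
move=> z oz; rewrite !srw_meanS !srw_stepE (perm_size (succs_transport oz nr)) size_map.
rewrite (perm_big _ (succs_transport oz nr)) big_map; congr (_ / _).
rewrite big_seq [RHS]big_seq; apply: eq_bigr => y zy; apply: ff'.
by rewrite -addn1; apply: gball_trans oz _; exact: succs_gball.
Qed.

Lemma card_gball_transport : card_gball g o r = card_gball g' (rg_root g') r.
Proof.
rewrite /card_gball -(surj_image_eq (set_bij_sub phi_bij) (set_bij_surj phi_bij)).
rewrite fset_set_image; last exact: finite_gball.
rewrite card_in_imfset// => x y; rewrite !in_fset_set; try exact: finite_gball.
exact: phi_inj.
Qed.

(** The triangle inequality: smaller balls around other vertices are contained in
    the ball around the root. *)
Lemma ball_iso_reroot k m x : gball g o k x -> (k + m <= r)%N ->
  ball_iso m (reroot g x) (reroot g' (phi x)).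
Proof.
move=> ox kmr.
have kr : (k <= r)%N by exact: leq_trans (leq_addr _ _) kmr.
have gx : vertex g x by apply: reachable_vertex ox.1; exact: rg_root_vertex.
have gx' : vertex g' (phi x).
  by apply: reachable_vertex (gball_transport ox kr).1; exact: rg_root_vertex.
have [eg ex] := rerootE gx; have [eg' ex'] := rerootE gx'.
have ball_x y : gball g x m y -> gball g o r y.
  by move=> xy; apply: (@gball_le _ _ _ _ kmr); exact: gball_trans xy.
exists phi; rewrite eg ex eg' ex'; split=> //; last first.
  by move=> y z /ball_x ? /ball_x ?; exact: phi_adj.
split.
- move=> y /gballP[n nm xy]; apply/gballP; exists n => //.
  by apply: walk_transport ox _ xy; apply: leq_trans kmr; rewrite leq_add2l.
- by move=> y z; rewrite !inE => /ball_x oy /ball_x oz; apply: phi_inj; rewrite inE.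
- move=> y' /gballP[n nm xy'].
  have [|y xy yE] := walk_lift ox _ xy'; first by apply: leq_trans kmr; rewrite leq_add2l.
  by exists y => //; apply/gballP; exists n.
Qed.

End transport.

Definition at_root (T : Type) (F : graph -> nat -> T) (g : rooted_graph) : T :=
  F g (rg_root g).

(** [F] depends on the isomorphism class of the ball of radius [r] only. *)
Definition ball_local (T : Type) r (F : graph -> nat -> T) : Prop :=
  forall g g', ball_iso r g g' -> at_root F g = at_root F g'.

Lemma local_card_gball r : ball_local r (fun g x => card_gball g x r).
Proof. by move=> g g' [phi [phi_bij _ _]]; exact: card_gball_transport phi_bij. Qed.

Lemma local_comp (T U : Type) r (F : graph -> nat -> T) (k : T -> U) :
  ball_local r F -> ball_local r (fun g x => k (F g x)).
Proof. by move=> F_loc g g' /F_loc; rewrite /at_root => ->. Qed.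

Lemma local_op (T U V : Type) r (F : graph -> nat -> T) (F' : graph -> nat -> U)
    (k : T -> U -> V) : ball_local r F -> ball_local r F' ->
  ball_local r (fun g x => k (F g x) (F' g x)).
Proof.
move=> F_loc F'_loc g g' gg'.
by move: (F_loc _ _ gg') (F'_loc _ _ gg'); rewrite /at_root => -> ->.
Qed.

Lemma local_srw_mean (R : realType) m n (F : graph -> nat -> R) :
  ball_local m F -> ball_local (m + n) (fun g => srw_mean g n (F g)).
Proof.
move=> F_loc g g' [phi [phi_bij phi_root phi_adj]].
apply: (srw_mean_transport phi_bij phi_root phi_adj); first exact: leq_addl.
move=> z oz.
have nm : (n + m <= m + n)%N by rewrite addnC.
have := F_loc _ _ (ball_iso_reroot phi_bij phi_root phi_adj oz nm).
have gz : vertex g z by apply: reachable_vertex oz.1; exact: rg_root_vertex.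
have gz' : vertex g' (phi z).
  have nr : (n <= m + n)%N by exact: leq_addl.
  apply: reachable_vertex (gball_transport phi_root phi_adj oz nr).1.
  exact: rg_root_vertex.
rewrite /at_root; have [-> ->] := rerootE gz; by have [-> ->] := rerootE gz'.
Qed.

Lemma local_entropy (R : realType) n : ball_local n (@entropy R ^~ n).
Proof.
move=> g g' [phi [phi_bij phi_root phi_adj]].
apply: (srw_mean_transport phi_bij phi_root phi_adj) => // z oz; congr (- ln _).
apply: (srw_mean_transport phi_bij phi_root phi_adj) => // y oy.
suff -> : (phi y == phi z) = (y == z) by [].
apply/eqP/eqP => [|->//]; apply: (set_bij_inj phi_bij); rewrite inE; exact.
Qed.

Lemma ball_iso_le m n (g g' : rooted_graph) : (m <= n)%N ->
  ball_iso n g g' -> ball_iso m g g'.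
Proof.
move=> mn [phi [phi_bij phi_root phi_adj]].
have := ball_iso_reroot phi_bij phi_root phi_adj (gball_refl _ _ 0) (_ : (0 + m <= n)%N).
rewrite phi_root; have reroot_root (k : rooted_graph) : reroot k (rg_root k) = k.
  rewrite /reroot; case: pselect => [kv|/(_ (rg_root_vertex k))//].
  by case: k kv => k o v kv /=; congr RGraph; exact: Prop_irrelevance.
by rewrite !reroot_root; apply.
Qed.

Lemma local_minfo (R : realType) n : ball_local n.+1 (fun g => @minfo R g n).
Proof.
apply: (local_op (F := @entropy R ^~ n.+1)
  (F' := fun g => srw_mean g 1 (@entropy R g n)) (fun a b => a - b)).
  exact: local_entropy.
rewrite -(addn1 n); apply: (@local_srw_mean _ _ _ (@entropy R ^~ n)).
exact: local_entropy.
Qed.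

Lemma local_info_growth (R : realType) N : ball_local N.+1 (fun g => @info_growth R g N).
Proof.
apply: (local_op (F := fun g x => \sum_(n < N) @minfo R g n x)
  (F' := fun g x => card_gball g x N.+1) (fun a b => a + 2 * ln b%:R)); last first.
  exact: local_card_gball.
move=> g g' gg'; apply: eq_bigr => n _; apply: local_minfo.
by apply: ball_iso_le gg'; rewrite ltnS ltnW.
Qed.

End ball_isomorphisms.

(** * Measurability of functions of a rooted ball *)

Section measurability.
Context {R : realType}.

(** A rooted ball as a subgraph of the natural numbers, encoded by a number. *)
Definition ball_code (r : nat) (g : rooted_graph) : nat :=
  let S := fball g (rg_root g) r in
  choice.pickle (S : seq nat, [seq p <- [seq (x, y) | x <- S, y <- S] | adj g p.1 p.2],
    rg_root g).

Lemma ball_code_iso r g g' : ball_code r g = ball_code r g' -> ball_iso r g g'.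
Proof.
move=> /(pcan_inj choice.pickleK) [S_seq E_eq o_eq].
have S_eq : fball g (rg_root g) r = fball g' (rg_root g') r.
  by apply/fsetP => x; rewrite -[RHS]/(x \in enum_fset _) -S_seq.
set S := fball g (rg_root g) r in S_eq E_eq.
have ballE x : gball g (rg_root g) r x <-> gball g' (rg_root g') r x.
  by rewrite -!in_fball -/S S_eq.
exists id; split=> //.
  split=> [x /ballE //|x y _ _ //|x /ballE ox]; by exists x.
move=> x y /in_fball xS /in_fball yS.
have := congr1 (fun s => (x, y) \in s) E_eq.
rewrite !mem_filter -S_eq /=.
have -> : (x, y) \in [seq (x0, y0) | x0 <- S, y0 <- S] by apply/allpairsP; exists (x, y).
by rewrite !andbT.
Qed.

(** There are only countably many rooted balls, hence a set defined through the
    ball of radius [r] is a countable union of generators. *)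
Lemma local_measurable r (F : graph -> nat -> R) : ball_local r F ->
  measurable_fun setT (fun g : rooted_graph_space => at_root F g).
Proof.
move=> F_loc _ B mB; rewrite setTI.
pose good k (g : rooted_graph) := ball_code r g = k /\ B (at_root F g).
pose rep k : rooted_graph := xget point (good k).
pose D k : set rooted_graph_space :=
  [set g' | good k (rep k) /\ ball_iso r (rep k) g'].
have -> : (fun g : rooted_graph_space => at_root F g) @^-1` B = \bigcup_k D k.
  apply/seteqP; split=> [g Bg|g' [k _ [[_ Bg] /F_loc gg']]]; last first.
    by rewrite /preimage /= -gg'.
  have gg : good (ball_code r g) (rep (ball_code r g)) by apply: xgetPex; exists g.
  by exists (ball_code r g) => //; split=> //; apply: ball_code_iso; exact: gg.1.
apply: bigcupT_measurable => k.
have [gk|gk] := pselect (good k (rep k)).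
  have -> : D k = [set g' | ball_iso r (rep k) g'].
    by apply/seteqP; split=> [g' []|].
  by apply: sub_sigma_algebra; exists r, (rep k).
have -> : D k = set0 by apply/seteqP; split=> // g' [].
exact: measurable0.
Qed.

End measurability.

(** * Stationarity for functions of a rooted ball *)

Section stationarity.
Context d (T : measurableType d) (R : realType) (P : probability T R).
Variable G : {RV P >-> rooted_graph_space}.

Let Q n (F : graph -> nat -> R) (w : T) : R :=
  let g : rooted_graph := G w in srw_mean g n (F g) (rg_root g).

Lemma measurable_srw_mean r n (F : graph -> nat -> R) : ball_local r F ->
  measurable_fun setT (fun w => (Q n F w)%:E).
Proof.
move=> F_loc; have mF := local_measurable (@local_srw_mean R r n F F_loc).
apply: measurableT_comp => //.
exact: (measurableT_comp mF (measurable_funPT G)).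
Qed.

Let Q_ge0 n (F : graph -> nat -> R) w : (forall g x, 0 <= F g x) -> 0 <= Q n F w.
Proof. by move=> F0; apply: srw_mean_ge0. Qed.

(** The ball codes number the values of [F], the inverse of the numbering being
    defined on all of [nat]. *)
Lemma local_countable_values r (F : graph -> nat -> R) : ball_local r F ->
  exists k : R -> nat, exists c : nat -> R,
  (forall g, c (k (at_root F g)) = at_root F g) /\
  (forall i, exists g, c i = at_root F g).
Proof.
move=> F_loc.
pose rep i : rooted_graph := xget point [set g | ball_code r g = i].
exists (fun v => ball_code r (xget point [set g | at_root F g = v])).
exists (fun i => at_root F (rep i)); split=> [g|i]; last by exists (rep i).
set g' := xget point _.
have <- : at_root F g' = at_root F g.
  by apply: (@xgetPex _ point [set h | at_root F h = at_root F g]); exists g.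
apply/F_loc/ball_code_iso.
by apply: (@xgetPex _ point [set h | ball_code r h = ball_code r g']); exists g'.
Qed.

Lemma eventually_nneseries (u : nat -> \bar R) (s : \bar R) N :
  (forall n, (N <= n)%N -> (\sum_(0 <= i < n) u i = s)%E) ->
  (\sum_(i <oo) u i = s)%E.
Proof.
move=> us; apply: lim_near_cst; first exact: ereal_hausdorff.
by exists N => // n /us.
Qed.

(** [F] is decomposed into the countably many events on which it is constant. *)
Lemma integral_srw_mean_series r n (F : graph -> nat -> R)
    (k : R -> nat) (c : nat -> R) : ball_local r F ->
  (forall g, c (k (at_root F g)) = at_root F g) -> (forall i, 0 <= c i) ->
  (\int[P]_w (Q n F w)%:E =
   \sum_(i <oo) (c i)%:E * \int[P]_w (Q n (fun g x => (k (F g x) == i)%:R) w)%:E)%E.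
Proof.
move=> F_loc ck c0.
pose I i g x : R := (k (F g x) == i)%:R.
have I_loc i : ball_local r (I i) by exact: (local_comp (fun v => (k v == i)%:R)).
transitivity (\int[P]_w (\sum_(i <oo) (c i)%:E * (Q n (I i) w)%:E)%E)%E.
  apply: eq_integral => w _; symmetry.
  set g : rooted_graph := G w; pose B := fball g (rg_root g) n.
  apply: (@eventually_nneseries _ _ (\max_(x <- B) k (F g x)).+1) => m Bm.
  under eq_bigr do rewrite -EFinM /Q -srw_mean_scale.
  rewrite sumEFin -srw_mean_sum; congr EFin; apply: eq_srw_mean => x ox.
  have km : (k (F g x) < m)%N.
    apply: leq_trans Bm; rewrite ltnS.
    by apply: (@leq_bigmax_seq _ _ xpredT (fun x => k (F g x))) => //; apply/in_fball.
  rewrite big_mkord (bigD1 (Ordinal km))//= /I eqxx mulr1 big1 ?addr0.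
    have gx : vertex g x by apply: reachable_vertex ox.1; exact: rg_root_vertex.
    by have := ck (reroot g x); rewrite /at_root; have [-> ->] := rerootE gx.
  move=> i; rewrite -val_eqE /= => ik.
  by rewrite eq_sym (negPf ik) mulr0.
rewrite integral_nneseries//=.
- apply: eq_eseriesr => i _; rewrite ge0_integralZl_EFin//.
  + by move=> w _; rewrite lee_fin Q_ge0// => g x; rewrite ler0n.
  + exact: measurable_srw_mean (I_loc i).
- move=> i; apply: measurable_funeM; exact: measurable_srw_mean (I_loc i).
- by move=> i w _; rewrite mule_ge0 ?lee_fin// Q_ge0// => g x; rewrite ler0n.
Qed.

Hypothesis G_stat : stationary G.

(** Stationarity, assumed for events, extends to the functions that take countably
    many values on events. *)
Lemma integral_srw_mean1 r (F : graph -> nat -> R) :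
  ball_local r F -> (forall g x, 0 <= F g x) ->
  (\int[P]_w (Q 1 F w)%:E = \int[P]_w (Q 0 F w)%:E)%E.
Proof.
move=> F_loc F0; have [k [c [ck c0]]] := local_countable_values F_loc.
have {}c0 i : 0 <= c i by have [g ->] := c0 i; exact: F0.
rewrite !(integral_srw_mean_series _ F_loc ck c0); apply: eq_eseriesr => i _.
congr (_ * _)%E.
pose A : set rooted_graph_space := [set g | k (at_root F (g : rooted_graph)) = i].
have mA : measurable A.
  have I_loc : ball_local r (fun g x => (k (F g x) == i)%:R : R).
    exact: (local_comp (fun v => (k v == i)%:R)).
  have := local_measurable I_loc measurableT (measurable_set1 (1 : R)).
  rewrite setTI; congr measurable; apply/seteqP; split=> g /=; rewrite /at_root /A /=.
    by case: eqP => // _ /eqP; rewrite eq_sym oner_eq0.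
  by move=> ->; rewrite eqxx.
have law_atE n : law_at G n A = (\int[P]_w (Q n (fun g x => (k (F g x) == i)%:R) w)%:E)%E.
  rewrite /law_at unlock; apply: eq_integral => w _; congr EFin.
  apply: eq_srw_mean => x ox.
  have gx : vertex (G w : rooted_graph) x.
    by apply: reachable_vertex ox.1; exact: rg_root_vertex.
  rewrite indicE; have [eg ex] := rerootE gx.
  suff -> : (reroot (G w) x \in A) = (k (F (G w : rooted_graph) x) == i) by [].
  by apply/idP/eqP; rewrite inE /A /at_root /= eg ex.
by rewrite -!law_atE -G_stat.
Qed.

Lemma integral_srw_mean r n (F : graph -> nat -> R) :
  ball_local r F -> (forall g x, 0 <= F g x) ->
  (\int[P]_w (Q n F w)%:E = \int[P]_w (Q 0 F w)%:E)%E.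
Proof.
move=> F_loc F0; elim: n => [//|n IH].
rewrite -IH -[RHS](@integral_srw_mean1 (r + n) (fun g => srw_mean g n (F g))).
- by [].
- exact: local_srw_mean.
- by move=> g x; exact: srw_mean_ge0.
Qed.

End stationarity.

(** * Growth of information in a stationary random graph *)

Section growth.
Context d (T : measurableType d) (R : realType) (P : probability T R).
Variable G : {RV P >-> rooted_graph_space}.
Hypothesis G_stat : stationary G.

Local Notation Q n F w :=
  (srw_mean (G w : rooted_graph) n (F (G w : rooted_graph))
    (rg_root (G w : rooted_graph))).

Let ln_ball r (g : graph) (x : nat) : R := ln (card_gball g x r)%:R.

Lemma ln_card_gball_ge0 (g : graph) x r : 0 <= ln (card_gball g x r)%:R :> R.
Proof. by apply: ln_ge0; rewrite ler1n card_gball_gt0. Qed.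

(** By stationarity the entropy after [n] steps has the same mean seen from the
    first position as from the root, so that the mutual informations telescope. *)
Lemma integral_sum_minfo N :
  (\int[P]_w (\sum_(n < N) Q 0 (fun g => @minfo R g n) w)%:E =
   \int[P]_w (Q 0 (@entropy R ^~ N) w)%:E)%E.
Proof.
have m_minfo n := @measurable_srw_mean _ _ _ P G _ 0 _ (@local_minfo R n).
have m_ent m n := @measurable_srw_mean _ _ _ P G _ m _ (@local_entropy R n).
elim: N => [|N IH].
  apply: eq_integral => w _; congr EFin; rewrite big_ord0; symmetry.
  exact: entropy0.
have sum0 w : (0 <= (\sum_(n < N) Q 0 (fun g => @minfo R g n) w)%:E)%E.
  by rewrite lee_fin sumr_ge0// => n _; exact: minfo_ge0.
have minfo0 w : (0 <= (Q 0 (fun g => @minfo R g N) w)%:E)%E.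
  by rewrite lee_fin minfo_ge0.
have m_sum : measurable_fun setT
    (fun w => (\sum_(n < N) Q 0 (fun g => @minfo R g n) w)%:E).
  by under eq_fun do rewrite -sumEFin; apply: emeasurable_sum => n; exact: m_minfo.
under eq_integral do rewrite big_ord_recr EFinD.
rewrite (ge0_integralD P measurableT (fun w _ => sum0 w) m_sum
  (fun w _ => minfo0 w) (m_minfo N)).
rewrite IH -(integral_srw_mean1 G_stat (@local_entropy R N)); last first.
  by move=> g x; exact: entropy_ge0.
rewrite -ge0_integralD//.
- apply: eq_integral => w _; rewrite -EFinD; congr EFin.
  by rewrite addrC subrK.
- by move=> w _; rewrite lee_fin srw_mean_ge0// => y _; exact: entropy_ge0.
Qed.

Lemma info_growth_ge0 (g : graph) N x : 0 <= info_growth g N x :> R.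
Proof.
rewrite addr_ge0// ?mulr_ge0 ?ln_card_gball_ge0//.
by apply: sumr_ge0 => n _; exact: minfo_ge0.
Qed.

Hypothesis G_growth : weakly_annealed_polynomial_growth G.

(** Each summand of [info_growth] has a mean at most that of the logarithm of the
    size of a ball, and [ln r] is below a harmonic number. *)
Lemma integral_info_growth_le : exists2 C : R, 0 <= C & forall k N,
  (\int[P]_w (Q k (fun g => @info_growth R g N.+1) w)%:E <= (C * hsum N.+1)%:E)%E.
Proof.
have [c [s [c0 s0 growth]]] := G_growth.
exists (3 * (s + c)) => [|k N]; first by rewrite mulr_ge0// addr_ge0.
rewrite (integral_srw_mean G_stat k (@local_info_growth R N.+1)); last first.
  by move=> g x; exact: info_growth_ge0.
have m_ball r := @measurable_srw_mean _ _ _ P G _ 0 _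
  (local_comp (fun b => ln b%:R : R) (@local_card_gball r)).
have m_info := @measurable_srw_mean _ _ _ P G _ 0 _ (@local_info_growth R N.+1).
have m_minfo n := @measurable_srw_mean _ _ _ P G _ 0 _ (@local_minfo R n).
have m_ent n := @measurable_srw_mean _ _ _ P G _ 0 _ (@local_entropy R n).
have {}growth r : (1 <= r)%N ->
    (\int[P]_w (Q 0 (ln_ball r) w)%:E <= (s * ln r%:R + c)%:E)%E.
  by move=> /growth; rewrite unlock.
have ball0 r w : (0 <= (Q 0 (ln_ball r) w)%:E)%E by rewrite lee_fin ln_card_gball_ge0.
apply: (@le_trans _ _ (3%:E * \int[P]_w (Q 0 (ln_ball N.+2) w)%:E)%E); last first.
  rewrite -mulrA EFinM; apply: lee_wpmul2l; first by rewrite lee_fin.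
  apply: le_trans (growth N.+2 isT) _; rewrite lee_fin mulrDl; apply: lerD.
    by apply: ler_wpM2l => //; exact: ln_le_hsum.
  rewrite ler_peMr// (le_trans _ (hsum_le (ltn0Sn N)))//.
  by rewrite hsumS /hsum big_ord0; lra.
apply: (@le_trans _ _ (\int[P]_w ((\sum_(n < N.+1) Q 0 (fun g => @minfo R g n) w)%:E +
    2%:E * (Q 0 (ln_ball N.+2) w)%:E))%E).
  rewrite le_eqVlt; apply/orP; left; apply/eqP; apply: eq_integral => w _.
  by rewrite -EFinM -EFinD.
have sum0 w : (0 <= (\sum_(n < N.+1) Q 0 (fun g => @minfo R g n) w)%:E)%E.
  by rewrite lee_fin sumr_ge0// => n _; exact: minfo_ge0.
have m_sum : measurable_fun setT
    (fun w => (\sum_(n < N.+1) Q 0 (fun g => @minfo R g n) w)%:E).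
  by under eq_fun do rewrite -sumEFin; apply: emeasurable_sum => n; exact: m_minfo.
have ball20 w : (0 <= 2%:E * (Q 0 (ln_ball N.+2) w)%:E)%E by rewrite mule_ge0.
rewrite (ge0_integralD P measurableT (fun w _ => sum0 w) m_sum
  (fun w _ => ball20 w)); last first.
  by apply: measurable_funeM; exact: m_ball.
rewrite ge0_integralZl_EFin//; last exact: m_ball.
rewrite integral_sum_minfo (_ : 3%:E = 1%:E + 2%:E)%E; last first.
  by rewrite -EFinD; congr EFin; lra.
rewrite ge0_muleDl ?lee_fin// mul1e; apply: leeD => //.
apply: (ge0_le_integral P measurableT _ (m_ent N.+1) (m_ball N.+2)) => w _.
  by rewrite lee_fin entropy_ge0.
rewrite lee_fin; apply: le_trans (entropy_le _ _ _) _.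
by rewrite ler_ln ?posrE ?ltr0n ?card_gball_gt0// ler_nat card_gball_le.
Qed.

(** Fatou's lemma for [info_growth] over [hsum].  The means over [k] steps reach the
    vertices other than the root. *)
Lemma ae_info_growth : {ae P, forall w, forall k, exists M : R, forall N0,
  exists2 N, (N0 <= N)%N & Q k (fun g => @info_growth R g N) w <= M * hsum N}.
Proof.
apply/ae_foralln => k.
have [C C0 growth] := integral_info_growth_le.
have hs0 N : 0 < hsum N.+1 :> R.
  apply: lt_le_trans (hsum_le (ltn0Sn N)).
  by rewrite hsumS /hsum big_ord0; lra.
pose f N w : \bar R :=
  ((hsum N.+1)^-1%:E * (Q k (fun g => @info_growth R g N.+1) w)%:E)%E.
have Q0 N w : 0 <= Q k (fun g => @info_growth R g N) w.
  by apply: srw_mean_ge0 => y _; exact: info_growth_ge0.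
have f0 N w : (0 <= f N w)%E.
  by rewrite mule_ge0// lee_fin// invr_ge0 ltW.
have mQ N := @measurable_srw_mean _ _ _ P G _ k _ (@local_info_growth R N).
have mf N : measurable_fun setT (f N) by exact: measurable_funeM.
have intf N : (\int[P]_w f N w <= C%:E)%E.
  rewrite ge0_integralZl_EFin// ?invr_ge0 ?(ltW (hs0 _))//.
    by rewrite lee_pdivrMl// -EFinM mulrC; exact: growth.
  by move=> w _; rewrite lee_fin.
pose X w := limn_einf (f ^~ w).
have mX : measurable_fun setT X.
  apply: (measurableT_comp (@oppe_measurable R setT)).
  apply: (@measurable_fun_limn_esup _ _ _ _ (fun n w => (- f n w)%E)) => n.
  exact: (measurableT_comp (@oppe_measurable R setT)).
have X0 w : (0 <= X w)%E.
  rewrite /X limn_einf_lim; apply: lime_ge; first exact: is_cvg_einfs.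
  by apply: nearW => n; apply/ereal_infP => _ [m _ <-].
have intX : (\int[P]_w X w <= C%:E)%E.
  apply: le_trans (fatou _ _ _ _) _ => //.
  rewrite limn_einf_lim; apply: lime_le; first exact: is_cvg_einfs.
  apply: nearW => n; apply: le_trans (intf n); apply: ereal_inf_lbound.
  by exists n => //=.
have : {ae P, forall w, setT w -> X w \is a fin_num}.
  apply: integrable_ae => //; apply/integrableP; split=> //.
  apply: le_lt_trans (ltry C); apply: le_trans intX.
  by under eq_integral do rewrite gee0_abs//.
apply: filterS => w /(_ I) Xfin; exists (fine (X w) + 1) => N0.
have : (einfs (f ^~ w) N0 < (fine (X w) + 1)%:E)%E.
  apply: (@le_lt_trans _ _ (X w)); last first.
    by rewrite -{1}(fineK Xfin) lte_fin ltrDl.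
  rewrite /X limn_einf_lim; apply: lime_ge; first exact: is_cvg_einfs.
  by exists N0 => // n /= N0n; exact: nondecreasing_einfs.
move=> /ereal_inf_lt[_ [N /= N0N <-]] fN; exists N.+1; first exact: leqW.
move: fN; rewrite /f -EFinM lte_fin ltr_pdivrMl// mulrC => /ltW.
by rewrite mulrC.
Qed.

End growth.

(** * Sublinear functions *)

Section sublinear_functions.
Context {R : realType}.

(** Otherwise there are vertices [x n] violating the bound with constant [n]; balls
    being finite, they leave every ball, and [h] is not sublinear along them. *)
Lemma sublinear_le (g : rooted_graph) (h : nat -> R) : connected_graph g ->
  sublinear g h -> forall e, 0 < e -> exists C, forall z, vertex g z ->
  `|h z| <= e * (gdist g (rg_root g) z)%:R + C.
Proof.
move=> g_conn h_sub e e0; apply: contrapT => unbounded.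
have /choice[x x_large] : forall n : nat, exists z, vertex g z /\
    e * (gdist g (rg_root g) z)%:R + n%:R < `|h z|.
  move=> n; apply: contrapT => bounded; apply: unbounded; exists n%:R => z gz.
  by rewrite leNgt; apply/negP => hz; apply: bounded; exists z.
have far : gdist g (rg_root g) (x n) @[n --> \oo] --> \oo.
  apply/cvgnyPge => A.
  pose M := \sum_(z <- fball g (rg_root g) A) `|h z|.
  exists (Num.bound M) => // n /= Mn; rewrite leqNgt; apply/negP => dA.
  have [gx hx] := x_large n.
  have xA : x n \in fball g (rg_root g) A.
    apply/in_fball; split; last exact: ltnW.
    by apply: g_conn => //; exact: rg_root_vertex.
  have : `|h (x n)| <= M.
    by rewrite /M (bigD1_seq (x n)) ?fset_uniq//= lerDl sumr_ge0.
  apply/negP; rewrite -ltNge; apply: le_lt_trans hx.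
  have M0 : 0 <= M by apply: sumr_ge0.
  apply: (@le_trans _ _ n%:R); last by rewrite lerDr mulr_ge0// ltW.
  by apply: le_trans (ltW (archi_boundP M0)) _; rewrite ler_nat.
have /cvgr0_norm_lt/(_ e e0) small := h_sub x (fun n => (x_large n).1) far.
have /cvgnyPge/(_ 1%N) pos := far.
have [n [/= sn pn]] : exists n,
    Num.norm (`|h (x n)| / (gdist g (rg_root g) (x n))%:R) < e /\ (0 < gdist g (rg_root g) (x n))%N.
  by have [N _ HN] := filterI small pos; exists N; exact: (HN N (leqnn N)).
move: sn; apply/negP; rewrite -leNgt ger0_norm ?divr_ge0//.
rewrite ler_pdivlMr ?ltr0n//; apply: le_trans (ltW (x_large n).2).
by rewrite lerDl.
Qed.

Lemma sublinear_sqr_le (g : rooted_graph) (h : nat -> R) (x : nat) :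
  connected_graph g -> sublinear g h -> vertex g x ->
  forall e, 0 < e -> exists C, forall z, reachable g x z ->
  (h z - h x) ^+ 2 <= e * (gdist g x z).+1%:R ^+ 2 + C.
Proof.
move=> g_conn h_sub gx e e0.
have [e' e'0 e'e] : exists2 e' : R, 0 < e' & 2 * e' ^+ 2 <= e.
  have [e1|e1] := lerP e 1.
    by exists (e / 2); nra.
  by exists (1 / 2); nra.
have [C hC] := sublinear_le g_conn h_sub e'0.
pose C' := e' * (gdist g (rg_root g) x)%:R + C + `|h x|.
exists (2 * C' ^+ 2) => z xz.
have gz : vertex g z by exact: reachable_vertex xz.
have ox : reachable g (rg_root g) x by apply: g_conn => //; exact: rg_root_vertex.
have dz : (gdist g (rg_root g) z)%:R <=
    (gdist g (rg_root g) x)%:R + (gdist g x z)%:R :> R.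
  rewrite -natrD ler_nat; apply: gdist_le.
  exact: walk_cat (gdist_walk ox) (gdist_walk xz).
have hzx : `|h z - h x| <= e' * (gdist g x z).+1%:R + C'.
  apply: le_trans (ler_normB _ _) _; have := hC z gz.
  have := ler_wpM2l (ltW e'0) dz; rewrite -natr1 /C'; lra.
rewrite -(real_normK (num_real _)).
have : 0 <= `|h z - h x| by [].
move: hzx; set a := `|_|; set b : R := (_.+1)%:R => ab a0.
have : a ^+ 2 <= (e' * b + C') ^+ 2 by rewrite ler_sqr ?nnegrE//; lra.
have := sqr_ge0 (e' * b - C'); have := ler_wpM2r (sqr_ge0 b) e'e; nra.
Qed.

End sublinear_functions.

(** * Absence of sublinear harmonic functions *)

Theorem theorem1p3 (d : measure_display) (T : measurableType d) (R : realType)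
    (P : probability T R) (G : {RV P >-> rooted_graph_space})
    (G_connected : {ae P, forall w, connected_graph (G w : rooted_graph)})
    (G_stationary : stationary G)
    (G_growth : weakly_annealed_polynomial_growth G) :
  {ae P, forall w, ~ exists h : nat -> R,
    [/\ harmonic_on (G w : rooted_graph) h, nonconstant (G w : rooted_graph) h &
        sublinear (G w : rooted_graph) h]}.
Proof.
have := ae_info_growth G_stationary G_growth.
apply: filterS2 G_connected => w; move: (G w : rooted_graph) => g g_conn g_info.
move=> [h [h_harm [x [y [gx gy hxy]]] h_sub]]; apply: hxy.
have h_edge u v : vertex g u -> adj g u v -> h v = h u.
  move=> gu uv; apply: (@gradient_eq0 R g u h) (adj_succs uv).
  - by move=> z uz; apply: h_harm; exact: reachable_vertex uz.
  - exact: sublinear_sqr_le.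
  have [k ou] : reachable g (rg_root g) u by apply: g_conn => //; exact: rg_root_vertex.
  have [M infoM] := g_info k; have p0 := @hk_gt0 R _ _ _ _ ou.
  set p := heat_kernel g k (rg_root g) u in p0.
  (* The walk is at [u] at time [k] with probability [p], hence the mean of the
     information over [k] steps is at least [p] times its value at [u]. *)
  exists (M / p) => N0; have [N N0N infoN] := infoM N0; exists N => //.
  rewrite mulrAC ler_pdivlMr//; apply: le_trans infoN.
  rewrite -srw_mean_scale; apply: srw_mean_le => z _.
  case: eqP => [->|_]; first by rewrite mulr1.
  by rewrite mulr0 info_growth_ge0.
have [n] := g_conn x y gx gy.
elim: n x gx => [x _ /walk0->//|n IH x gx /walkS[z xz zy]].
have gz : vertex g z by apply: (@adj_vertex g z x); rewrite adj_sym.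
by rewrite -(h_edge x z)//; exact: IH.
Qed.
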